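(* Let $\Phi=\{\varphi_\nu\}_{\nu=1}^\infty\subset\mathcal A(\mathbb R^n)$ be a family satisfying the following conditions: (i$_0$) for each $\nu\in\mathbb N$ and each $A>0$ there is a constant $C_{\nu,A}>0$ such that $\varphi_\nu(x)+A\ln(1+\|x\|)\le\varphi_{\nu+1}(x)+C_{\nu,A}$ for all $x\in\mathbb R^n$; (i$_1$) for each $\nu\in\mathbb N$ there exist constants $\sigma_\nu>1$ and $\gamma_\nu>0$ such that $\varphi_\nu(\sigma_\nu x)\le\varphi_{\nu+1}(x)+\gamma_\nu$ for all $x\in\mathbb R^n$; (i$_2$) for each $\nu\in\mathbb N$ there exists a constant $K_\nu>0$ such that $\varphi_\nu(x+\xi)\le\varphi_{\nu+1}(x)+K_\nu$ for all $x\in[0,\infty)^n$, $\xi\in[0,1]^n$. Then each function $f\in\mathcal E(\Psi^* )$ admits a unique extension to an entire function on $\mathbb C^n$, and this extension belongs to $E(\Phi)$.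
   Context: Let $n\in\mathbb N$; $\mathbb Z_+=\{0,1,2,\dots\}$; $\|\cdot\|$ is the Euclidean norm on $\mathbb R^n$ and $\mathbb C^n$; $\langle u,v\rangle=u_1v_1+\cdots+u_nv_n$; for $z\in\mathbb C^n$, $\operatorname{Im}z=(\operatorname{Im}z_1,\dots,\operatorname{Im}z_n)$; $H(\mathbb C^n)$ is the space of entire functions on $\mathbb C^n$. Standard multi-index notation is used ($\alpha!=\alpha_1!\cdots\alpha_n!$, $D^\alpha=\partial^{|\alpha|}/\partial x_1^{\alpha_1}\cdots\partial x_n^{\alpha_n}$). $\mathcal A(\mathbb R^n)$ is the set of all real-valued $g\in C(\mathbb R^n)$ such that: 1) $g(x)=g(|x_1|,\dots,|x_n|)$ for all $x\in\mathbb R^n$; 2) the restriction of $g$ to $[0,\infty)^n$ is nondecreasing in each variable; 3) $\lim_{x\to\infty}g(x)/\|x\|=+\infty$. For $g:\mathbb R^n\to[-\infty,+\infty]$ the Young-Fenchel conjugate is $g^*(x)=\sup_{y\in\mathbb R^n}(\langle x,y\rangle-g(y))$, $x\in\mathbb R^n$. Put $\psi_\nu(x)=\varphi_\nu(e^{x_1},\dots,e^{x_n})$ for $x\in\mathbb R^n$. $E(\Phi)=\bigcup_{\nu\ge1}E(\varphi_\nu)$, where $E(\varphi_\nu)$ is the set of all $f\in H(\mathbb C^n)$ such that for every $m\in\mathbb Z_+$ $$p_{\nu,m}(f)=\sup_{z\in\mathbb C^n}\frac{|f(z)|(1+\|z\|)^m}{e^{\varphi_\nu(\operatorname{Im}z)}}<\infty.$$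 $\mathcal E(\Psi^* )=\bigcup_{\nu\ge1}\mathcal E(\psi_\nu^* )$, where $\mathcal E(\psi_\nu^* )$ is the set of all (complex-valued) $f\in C^\infty(\mathbb R^n)$ such that for every $m\in\mathbb Z_+$ $$\rho_{m,\nu}(f)=\sup_{x\in\mathbb R^n,\ \alpha\in\mathbb Z_+^n}\frac{(1+\|x\|)^m|(D^\alpha f)(x)|}{\alpha!\,e^{-\psi_\nu^*(\alpha)}}<\infty.$$ *)

(* Defs.v *)
From HB Require Import structures.
From mathcomp Require Import all_boot all_order all_algebra.
From mathcomp Require Import all_classical all_reals all_analysis.
From mathcomp Require Import complex.

Set Implicit Arguments.
Unset Strict Implicit.
Unset Printing Implicit Defensive.

Import Order.TTheory GRing.Theory Num.Theory.
Import numFieldNormedType.Exports.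
Import ComplexField.Normc.

Local Open Scope classical_set_scope.
Local Open Scope ring_scope.

Section vectors.
Context {R : realType} {n : nat}.

(* The library norm [`|x|] on ['rV[R]_n] is the max norm, hence these. *)
Definition enorm (x : 'rV[R]_n) : R := Num.sqrt (\sum_(i < n) x 0 i ^+ 2).

Definition cnorm (z : 'rV[R[i]]_n) : R :=
  Num.sqrt (\sum_(i < n) normc (z 0 i) ^+ 2).

Definition dotv (x y : 'rV[R]_n) : R := \sum_(i < n) x 0 i * y 0 i.

Definition ImV (z : 'rV[R[i]]_n) : 'rV[R]_n := map_mx (@complex.Im R) z.

Definition real_to_complexV (x : 'rV[R]_n) : 'rV[R[i]]_n :=
  map_mx (real_complex R) x.

End vectors.

Section weights.
Context {R : realType} {n : nat}.

Definition orthant : set 'rV[R]_n := [set x | forall i, 0 <= x 0 i].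

Definition class_A : set ('rV[R]_n -> R) := [set g : 'rV[R]_n -> R |
  [/\ continuous g,
      forall x : 'rV[R]_n, g x = g (map_mx (fun t => `|t|) x),
      forall (x y : 'rV[R]_n) i, orthant x -> orthant y ->
        (forall j, j != i -> x 0 j = y 0 j) -> x 0 i <= y 0 i -> g x <= g y
    & forall M : R, exists r : R, forall x : 'rV[R]_n,
        r < enorm x -> M < g x / enorm x]].

Definition young_fenchel (g : 'rV[R]_n -> \bar R) (x : 'rV[R]_n) : \bar R :=
  ereal_sup [set ((dotv x y)%:E - g y)%E | y in [set: 'rV[R]_n]].

Definition exp_pullback (phi : 'rV[R]_n -> R) (x : 'rV[R]_n) : R :=
  phi (map_mx expR x).

End weights.

Section smooth_functions.
Context {R : realType} {n : nat}.

Definition partial (i : 'I_n) (u : 'rV[R]_n -> R) : 'rV[R]_n -> R :=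
  fun x => 'D_(delta_mx 0 i) u x.

(* All iterated partial derivatives, in any order of differentiation, exist
   and are continuous. *)
Definition smooth (u : 'rV[R]_n -> R) : Prop :=
  forall s : seq 'I_n, let g := foldr partial u s in
    continuous g /\ forall i x, derivable g x (delta_mx 0 i).

Definition mpartial (alpha : 'I_n -> nat) (u : 'rV[R]_n -> R) :
    'rV[R]_n -> R :=
  foldr (fun i v => iter (alpha i) (partial i) v) u (enum 'I_n).

(* [R[i]] carries no normed module structure over [R] in the library, so
   complex-valued functions are differentiated through their real and imaginary
   parts. *)
Definition csmooth (f : 'rV[R]_n -> R[i]) : Prop :=
  smooth (@complex.Re R \o f) /\ smooth (@complex.Im R \o f).

Definition cmpartial (alpha : 'I_n -> nat) (f : 'rV[R]_n -> R[i])
    (x : 'rV[R]_n) : R[i] :=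
  (mpartial alpha (@complex.Re R \o f) x
     +i* mpartial alpha (@complex.Im R \o f) x)%C.

Definition mfact (alpha : 'I_n -> nat) : nat := (\prod_(i < n) (alpha i)`!)%N.

Definition mvec (alpha : 'I_n -> nat) : 'rV[R]_n := \row_i (alpha i)%:R.

(* Taken in [\bar R] because the conjugate is extended-real-valued; for [psi]
   coming from a weight in [class_A] it is finite at every multi-index. *)
Definition rho (psi : 'rV[R]_n -> R) (m : nat) (f : 'rV[R]_n -> R[i]) : \bar R :=
  ereal_sup [set
    (((1 + enorm p.1) ^+ m * normc (cmpartial p.2 f p.1))%:E /
      ((mfact p.2)%:R%:E * expeR (- young_fenchel (EFin \o psi) (mvec p.2))))%E
    | p in [set: 'rV[R]_n * ('I_n -> nat)]].

Definition calE (psi : 'rV[R]_n -> R) : set ('rV[R]_n -> R[i]) :=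
  [set f | csmooth f /\ forall m, (rho psi m f < +oo)%E].

(* Here and below the families are indexed by [nu >= 1]; the member of index 0
   is never used. *)
Definition calE_Psi (phi : nat -> 'rV[R]_n -> R) : set ('rV[R]_n -> R[i]) :=
  \bigcup_(nu in [set nu | (0 < nu)%N]) calE (exp_pullback (phi nu)).

End smooth_functions.

Section entire_functions.
Context {R : realType} {n : nat}.

(* Differentiability is over the field [R[i]], that is, complex
   differentiability. *)
Definition entire (F : 'rV[R[i]]_n -> R[i]) : Prop :=
  forall z, differentiable (F : 'rV[R[i]]_n -> R[i]^o) z.

Definition pnorm (phi : 'rV[R]_n -> R) (m : nat) (F : 'rV[R[i]]_n -> R[i]) :
    \bar R :=
  ereal_sup [set
    (normc (F z) * (1 + cnorm z) ^+ m / expR (phi (ImV z)))%:E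
    | z in [set: 'rV[R[i]]_n]].

Definition E_space (phi : 'rV[R]_n -> R) : set ('rV[R[i]]_n -> R[i]) :=
  [set F | entire F /\ forall m, (pnorm phi m F < +oo)%E].

Definition E_Phi (phi : nat -> 'rV[R]_n -> R) : set ('rV[R[i]]_n -> R[i]) :=
  \bigcup_(nu in [set nu | (0 < nu)%N]) E_space (phi nu).

Definition entire_extension (f : 'rV[R]_n -> R[i]) (F : 'rV[R[i]]_n -> R[i]) :
    Prop :=
  entire F /\ forall x, F (real_to_complexV x) = f x.

End entire_functions.

(* Main.v *)
From HB Require Import structures.
Require Import Defs.
From mathcomp Require Import all_boot all_order all_algebra.
From mathcomp Require Import all_classical all_reals all_analysis.
From mathcomp Require Import complex ring lra.
Import Order.TTheory GRing.Theory Num.Theory.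
Import numFieldNormedType.Exports.
Import ComplexField.Normc.
Local Open Scope classical_set_scope.
Local Open Scope ring_scope.
Set Implicit Arguments.
Unset Strict Implicit.
Unset Printing Implicit Defensive.

(**
Let psi^ denote the Young-Fenchel conjugate of psi(y) = phi_nu(e^y).  Testing
the supremum that defines psi^(alpha) at y = ln r turns membership in
calE into Cauchy-type estimates, valid for all r in (0, oo)^n and all real x:

  |D^alpha f(x)| / alpha! <= C_m (1 + |x|)^-m e^{phi_nu(r)} r^-alpha

([coef_decay], [taylor_coef_dominated]).  Since r is arbitrary, the Taylor
series of f at x converges on all of C^n, to an entire function
([power_series_entire], [taylor_sum_entire]), and by Taylor's formula its sum
is f on R^n ([taylor_box], [taylor_sum_real]).  An entire function is
determined by its values on R^n ([entire_extension_unique]), so this gives the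
unique extension F and, moreover, shows that the Taylor series of f at all real
centres have the same sum ([taylor_sum_center]).  Hence F(x + iy) can be
estimated by the series with centre x, whose argument is iy.  With
r_i = sigma |y_i| + 1 that series is dominated by a geometric one of ratio
1 / sigma, so that |F(x + iy)| <= C (1 + |x|)^-m e^{phi_nu(r)}.  Then i2
absorbs the shift by 1, i1 the dilation by sigma, and i0 the polynomial factor
(1 + |y|)^m; each costs one step of the family, and F is in
E_space (phi nu.+3).

Uniqueness is the deep part, since entire means complex differentiable at each
point.  Restricting to complex lines through real
points leaves one function g of one variable, zero on R, for which g(i) = 0 is
wanted ([vanish_at_i]).  Goursat's bisection argument ([goursat]) is applied to
conj(g(i)) g(z) (1 - (z - i)^2 / 9)^N on the rectangle [-3, 3] x [0, 1].  The
bottom edge contributes nothing, the vertical edges O((7/9)^N), while on the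
top edge the kernel is real, nonnegative and peaks at i; if g(i) were not 0 the
top edge would contribute an integral that decays more slowly
([peak_concentration]).

Sums over multi-indices are taken over boxes, one coordinate after the other,
and Taylor's formula for f results from the one-variable formula applied to the
coordinates in turn: the partial derivatives then arise in the very order in
which [mpartial] takes them.
*)

(** * Integrals of continuous functions on the line *)

Section primitives.
Context {R : realType}.
Implicit Types f : R -> R.
Notation mu := (@lebesgue_measure R).

(** Extending the integral from a to the left of a would require an
    orientation, so the result is first proved on a half-line and glued in
    [has_primitive]. *)
Lemma primitive_right f (a : R) : continuous f ->
  exists P : R -> R, forall x : R, a < x -> is_derive x 1 P (f x).
Proof.
move=> cf; exists (fun x => \int[mu]_(t in `[a, x]) f t)%R => x ax.
have [] := @continuous_FTC1_closed R f a x (x + 1).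
- by rewrite ltrDl.
- apply: continuous_compact_integrable; first exact: segment_compact.
  exact: continuous_subspaceT.
- exact: ax.
- exact: cf.
move=> d1 d2; split; first exact: d1.
by rewrite -d2 derive1E.
Qed.

Lemma derive0_eq (f : R -> R) (a b : R) :
  (forall x : R, a < x -> x < b -> is_derive x 1 f 0) ->
  forall x y, a < x < b -> a < y < b -> f x = f y.
Proof.
move=> df.
have main x y : a < x < b -> a < y < b -> x <= y -> f x = f y.
  move=> /andP[ax xb] /andP[ay yb] xy.
  have [t zxy||c _ /eqP] := @MVT_segment R f (fun=> 0) x y xy.
  - by apply: df; move: zxy; rewrite in_itv /= => /andP[? ?]; lra.
  - apply: continuous_in_subspaceT => z; rewrite inE /= in_itv /= => /andP[? ?].
    apply: differentiable_continuous; apply/derivable1_diffP.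
    by apply: ex_derive; apply: df; lra.
  - by rewrite mul0r subr_eq0 => /eqP.
move=> x y hx hy; case: (leP x y) => xy; first exact: main.
by rewrite (main y x) // ltW.
Qed.

(** A primitive on (-1, oo) and a reflected one on (-oo, 1) differ by a
    constant on (-1, 1), hence can be glued at 0. *)
Lemma has_primitive f : continuous f ->
  exists P : R -> R, forall x : R, is_derive x 1 P (f x).
Proof.
move=> cf; have [P dP] := primitive_right (-1) cf.
have [] := @primitive_right (fun x => f (- x)) (-1).
  move=> x; apply: continuous_comp; [exact: opp_continuous|exact: cf].
move=> Q dQ.
pose Q' x := - Q (- x).
have dQ' (x : R) : x < 1 -> is_derive x 1 Q' (f x).
  move=> x1; rewrite /Q'.
  have dQx : is_derive (- x) 1 Q (f x).
    by rewrite -[X in f X]opprK; apply: dQ; lra.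
  have := @is_derive1_comp R Q (fun t => - t) x _ _ dQx _.
  move=> /(_ (-1) _) H.
  rewrite -[f x]opprK -[X in - X]mulrN1.
  by apply: is_deriveN; apply: H.
pose G x := if 0 <= x then P x - P 0 else Q' x - Q' 0.
have e1 x : -1 < x -> x < 1 -> P x - P 0 = Q' x - Q' 0.
  move=> x1 x2.
  have : (fun x => P x - Q' x) x = (fun x => P x - Q' x) 0.
    apply: (@derive0_eq (fun x => P x - Q' x) (-1) 1); [|lra|lra] => z z1 z2.
    rewrite -[0](subrr (f z)).
    by apply: is_deriveB; [exact: dP|exact: dQ'].
  move=> /= ?; lra.
exists G => x; case: (ltP x 0) => x0.
- have H : is_derive x 1 (fun x => Q' x - Q' 0) (f x).
    rewrite -[f x]subr0; apply: is_deriveB; exact: dQ' (lt_trans x0 ltr01).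
  apply: near_eq_is_derive H; near=> z.
  rewrite /G ifF //; apply/negbTE; rewrite -ltNge; near: z.
  exact: lt_nbhsl.
- have H : is_derive x 1 (fun x => P x - P 0) (f x).
    rewrite -[f x]subr0; apply: is_deriveB; apply: dP; lra.
  apply: near_eq_is_derive H; near=> z.
  have z1 : -1 < z by near: z; apply: lt_nbhsr; lra.
  rewrite /G; case: ifPn => //; rewrite -ltNge => z0.
  by apply: e1; lra.
Unshelve. all: by end_near. Qed.
End primitives.

Section integrals.
Context {R : realType}.
Implicit Types f : R -> R.

(** Only increments matter, so any primitive will do. *)
Definition primitive f : R -> R :=
  get [set P : R -> R | forall x : R, is_derive x 1 P (f x)].

(** The integral of f from a to b, as the increment of a primitive: it is
    additive in the interval by construction, and every estimate below is an
    instance of the mean value theorem. *)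
Definition integ f (a b : R) : R := primitive f b - primitive f a.

Lemma primitiveP f : continuous f ->
  forall x : R, is_derive x 1 (primitive f) (f x).
Proof.
move=> /has_primitive [P dP].
exact: (@getPex _ [set P : R -> R | forall x : R, is_derive x 1 P (f x)]
  (ex_intro _ P dP)).
Qed.

Lemma is_derive_MVT (P p : R -> R) (a b : R) : a <= b ->
  (forall x : R, is_derive x 1 P (p x)) ->
  exists2 c, a <= c <= b & P b - P a = p c * (b - a).
Proof.
move=> ab dP; have [|c cab ->] := @MVT_segment R P p a b ab.
- apply: continuous_in_subspaceT => z _.
  by apply: differentiable_continuous; apply/derivable1_diffP.
- by exists c => //; rewrite in_itv in cab.
Qed.

Lemma integ_mean f (a b : R) : a <= b -> continuous f ->
  exists2 c, a <= c <= b & integ f a b = f c * (b - a).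
Proof. by move=> ab cf; apply: is_derive_MVT => //; exact: primitiveP. Qed.

Lemma is_derive_affine_prim (p q : R) (x : R) :
  is_derive x 1 (fun t : R => p * t + q / 2 * t ^+ 2) (p + q * x).
Proof.
have dsq : is_derive x 1 (fun t : R => t * t) (x + x).
  have := @is_deriveM R R^o id id x 1 1 1 _ _.
  rewrite /GRing.scale /= !mulr1; exact.
have -> : (fun t : R => p * t + q / 2 * t ^+ 2) =
    (p \*: id) + ((q / 2) \*: (fun t => t * t)).
  by apply/funext => t /=; rewrite expr2.
have := is_deriveD (is_deriveZ p (is_derive_id x 1)) (is_deriveZ (q / 2) dsq).
by rewrite /GRing.scale /=; congr (is_derive _ _ _ _); field.
Qed.

(** The mean value theorem, applied to the difference of the two primitives;
    an affine function is integrated exactly. *)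
Lemma integ_near_affine f (a b p q e : R) : a <= b -> continuous f ->
  (forall x, a <= x <= b -> `|f x - (p + q * x)| <= e) ->
  `|integ f a b - (p * (b - a) + q / 2 * (b ^+ 2 - a ^+ 2))| <= e * (b - a).
Proof.
move=> ab cf fe.
have [|c cab] := @is_derive_MVT
  (fun x => primitive f x - (p * x + q / 2 * x ^+ 2))
  (fun x => f x - (p + q * x)) a b ab.
  move=> x; apply: is_deriveB; first exact: primitiveP.
  exact: is_derive_affine_prim.
move=> E.
have -> : integ f a b - (p * (b - a) + q / 2 * (b ^+ 2 - a ^+ 2)) =
  (f c - (p + q * c)) * (b - a) by rewrite -E /integ; ring.
rewrite normrM (ger0_norm (_ : 0 <= b - a)) ?subr_ge0//.
by apply: ler_wpM2r; [rewrite subr_ge0|apply: fe].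
Qed.

Lemma integ_cat f (a b c : R) : integ f a b + integ f b c = integ f a c.
Proof. by rewrite /integ; ring. Qed.
End integrals.

(** * Bisection of rectangles *)

Section bisection.
Context {R : realType}.

(** The left ends of nested intervals of length W / 2 ^ k; their supremum is a
    common point. *)
Lemma half_grid_limit (a : nat -> R) (W : R) : 0 <= W ->
  (forall k, a k.+1 = a k \/ a k.+1 = a k + W / 2 ^+ k.+1) ->
  exists p, forall k, a k <= p <= a k + W / 2 ^+ k.
Proof.
move=> W0 ha.
have s0 k : 0 <= W / 2 ^+ k by rewrite divr_ge0 ?exprn_ge0.
have half k : W / 2 ^+ k = W / 2 ^+ k.+1 + W / 2 ^+ k.+1.
  by rewrite exprS; field; rewrite expf_neq0//.
have inc k : a k <= a k.+1.
  by case: (ha k) => ->; rewrite ?lerDl.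
have dec k : a k.+1 + W / 2 ^+ k.+1 <= a k + W / 2 ^+ k.
  by rewrite (half k); have := s0 k.+1; case: (ha k) => ->; lra.
have up m j : a m <= a (m + j)%N.
  by elim: j => [|j IH]; rewrite ?addn0// addnS (le_trans IH).
have dn m j : a (m + j)%N + W / 2 ^+ (m + j)%N <= a m + W / 2 ^+ m.
  elim: j => [|j IH]; rewrite ?addn0// addnS; exact: le_trans (dec _) IH.
have bnd k m : a k <= a m + W / 2 ^+ m.
  case: (leqP k m) => [/subnKC km|/ltnW/subnKC km].
    by have := up k (m - k)%N; rewrite km => /le_trans; apply; rewrite lerDl.
  by have := dn m (k - m)%N; rewrite km; apply: le_trans; rewrite lerDl.
exists (sup (range a)) => k; apply/andP; split.
  apply: ub_le_sup; last by exists k.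
  by exists (a 0%N + W / 2 ^+ 0) => _ [j _ <-].
by apply: ge_sup => [|_ [j _ <-] //]; exists (a 0%N), 0%N.
Qed.

(** If Psi were not 0 at scale 1, one of the four quarters of each chosen
    rectangle would carry at least a quarter of its value. These rectangles
    shrink to a point (p, q), where Psi is smaller than e times the square of
    the scale for every e. *)
Lemma bisection_vanish (Psi : R -> R -> R -> R) (W H : R) : 0 <= W -> 0 <= H ->
  (forall a b s : R, 0 < s -> `|Psi a b s| <=
     `|Psi a b (s / 2)| + `|Psi (a + W * s / 2) b (s / 2)|
     + `|Psi a (b + H * s / 2) (s / 2)|
     + `|Psi (a + W * s / 2) (b + H * s / 2) (s / 2)|) ->
  (forall p q e : R, 0 < e -> exists2 d : R, 0 < d & forall a b s : R, 0 < s < d ->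
     a <= p <= a + W * s -> b <= q <= b + H * s -> `|Psi a b s| <= e * s ^+ 2) ->
  forall a b, Psi a b 1 = 0.
Proof.
move=> W0 H0 sub loc a b.
have step (c : R * R * R) : exists c' : R * R * R, 0 < c.2 ->
   [/\ c'.2 = c.2 / 2, `|Psi c.1.1 c.1.2 c.2| <= 4 * `|Psi c'.1.1 c'.1.2 c'.2|,
      c'.1.1 = c.1.1 \/ c'.1.1 = c.1.1 + W * c.2 / 2 &
      c'.1.2 = c.1.2 \/ c'.1.2 = c.1.2 + H * c.2 / 2].
  case: c => [[x y] s] /=.
  case: (ltP 0 s) => s0; last by exists (x, y, s).
  have h := sub x y s s0.
  case: (leP (`|Psi x y s|) (4 * `|Psi x y (s / 2)|)) => h1.
    by exists (x, y, s / 2) => _; split; [|exact: h1|left|left].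
  case: (leP (`|Psi x y s|) (4 * `|Psi (x + W * s / 2) y (s / 2)|)) => h2.
    by exists (x + W * s / 2, y, s / 2) => _; split; [|exact: h2|right|left].
  case: (leP (`|Psi x y s|) (4 * `|Psi x (y + H * s / 2) (s / 2)|)) => h3.
    by exists (x, y + H * s / 2, s / 2) => _; split; [|exact: h3|left|right].
  exists (x + W * s / 2, y + H * s / 2, s / 2) => _; split; [by []| |by right|by right].
  rewrite /=; lra.
have [next nextP] := choice step.
pose c k := iter k next (a, b, 1).
have cs k : (c k).2 = 2^-1 ^+ k.
  elim: k => [|k IH] //=; have [|-> _ _ _] := nextP (c k).
    by rewrite IH exprn_gt0.
  by rewrite IH exprSr.
have s0 k : 0 < (c k).2 by rewrite cs exprn_gt0.
have cPsi k : `|Psi a b 1| <= 4 ^+ k * `|Psi (c k).1.1 (c k).1.2 (c k).2|.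
  elim: k => [|k IH]; first by rewrite expr0 mul1r.
  apply: le_trans IH _; rewrite exprSr -mulrA.
  have [_ + _ _] := nextP (c k) (s0 k).
  by move=> ?; apply: ler_wpM2l => //; rewrite exprn_ge0.
have [p hp] : exists p, forall k, (c k).1.1 <= p <= (c k).1.1 + W / 2 ^+ k.
  apply: half_grid_limit => // k; have [_ _ + _] := nextP (c k) (s0 k).
  by rewrite -/(c k.+1) cs -mulrA -exprSr -exprVn.
have [q hq] : exists q, forall k, (c k).1.2 <= q <= (c k).1.2 + H / 2 ^+ k.
  apply: half_grid_limit => // k; have [_ _ _] := nextP (c k) (s0 k).
  by rewrite -/(c k.+1) cs -mulrA -exprSr -exprVn.
apply/eqP; rewrite -normr_le0; apply/ler_addgt0Pl => e e0; rewrite addr0.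
have [d d0 hd] := loc p q e e0.
have [k kd] : exists k, (2^-1 : R) ^+ k < d.
  have : (fun k => (2^-1 : R) ^+ k) @ \oo --> (0 : R).
    by apply: cvg_expr; rewrite ger0_norm ?invr_ge0// invf_lt1// ltr1n.
  move=> /cvgrPdist_lt /(_ d d0) [N _ /(_ N (leqnn N))] /=.
  by rewrite sub0r normrN ger0_norm ?exprn_ge0//; exists N.
apply: le_trans (cPsi k) _.
have := hd (c k).1.1 (c k).1.2 (c k).2.
rewrite cs exprn_gt0//= kd exprVn hp hq => /(_ isT isT isT) => h.
apply: (le_trans (ler_wpM2l _ h)); first by rewrite exprn_ge0.
have -> : (4 : R) = 2 * 2 by ring.
rewrite exprMn le_eqVlt; apply/orP; left; apply/eqP.
by field; rewrite expf_neq0.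
Qed.
End bisection.

(** * Complex modulus and complex derivative *)

Section complex_modulus.
Context {R : realType}.
Implicit Types z w : R[i].

Lemma normcE_norm z : `|z| = (normc z)%:C%C.
Proof. by case: z. Qed.

Lemma normc_ge0 z : 0 <= normc z.
Proof. by case: z => a b /=; exact: sqrtr_ge0. Qed.

Lemma normc_Re z : `|complex.Re z| <= normc z.
Proof.
case: z => a b /=; rewrite -sqrtr_sqr ler_wsqrtr//.
by rewrite lerDl sqr_ge0.
Qed.

Lemma normc_Im z : `|complex.Im z| <= normc z.
Proof.
case: z => a b /=; rewrite -sqrtr_sqr ler_wsqrtr//.
by rewrite lerDr sqr_ge0.
Qed.

Lemma normc_le_ReIm z : normc z <= `|complex.Re z| + `|complex.Im z|.
Proof.
case: z => a b /=; rewrite -[leRHS]ger0_norm ?addr_ge0// -sqrtr_sqr.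
rewrite ler_wsqrtr// -(real_normK (num_real a)) -(real_normK (num_real b)).
have := normr_ge0 a; have := normr_ge0 b; nra.
Qed.

Lemma normcX z n : normc (z ^+ n) = normc z ^+ n.
Proof. by elim: n => [|n IH]; rewrite ?normc1// !exprS normcM IH. Qed.

Lemma normc_real (x : R) : normc (x%:C)%C = `|x|.
Proof. by rewrite /= expr0n addr0 sqrtr_sqr. Qed.

Lemma normc_nat m : normc (m%:R : R[i]) = m%:R.
Proof. by rewrite -(rmorph_nat (real_complex R)) normc_real ger0_norm. Qed.

Lemma normc_prod n (F : 'I_n -> R[i]) :
  normc (\prod_i F i) = \prod_i normc (F i).
Proof. by apply: (big_morph _ (@normcM R)); exact: normc1. Qed.

Lemma normc_lipschitz z w : `|normc z - normc w| <= normc (z - w).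
Proof.
have h1 := le_normcD (z - w) w; have h2 := le_normcD (w - z) z.
rewrite !subrK in h1 h2; move: h2; rewrite -[w - z]opprB normcN => h2.
rewrite ler_norml; lra.
Qed.

Lemma ReB z w : complex.Re (z - w) = complex.Re z - complex.Re w.
Proof. by case: z w => [? ?] [? ?]. Qed.
Lemma ImB z w : complex.Im (z - w) = complex.Im z - complex.Im w.
Proof. by case: z w => [? ?] [? ?]. Qed.

End complex_modulus.

Section complex_derivative.
Context {R : realType}.
Implicit Types k : R[i] -> R[i].

(** Complex differentiability at z. The order of R[i] is partial, so that all
    estimates are carried out with the R-valued modulus. *)
Definition cdiff k z := exists c, forall e : R, 0 < e ->
  exists2 d : R, 0 < d & forall w, normc (w - z) < d ->
    normc (k w - k z - c * (w - z)) <= e * normc (w - z).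

Lemma derivable_cdiff k (z : R[i]) : derivable (k : R[i]^o -> R[i]^o) z 1 -> cdiff k z.
Proof.
move=> /derivable_nbhs /eqaddoP dk.
exists ('D_1 (k : R[i]^o -> R[i]^o) z) => e e0.
have eC : 0 < (e%:C)%C by rewrite ltcR.
have /nbhs_ballP [d d0 hd] := dk _ eC.
have dE : d = (complex.Re d)%:C%C.
  move: d0; rewrite /= ltcE => /andP[/eqP /= h _].
  by case: d h {hd} => a b /= ->.
exists (complex.Re d) => [|w wd].
  by move: d0; rewrite dE /= ltcR.
have := hd (w - z); rewrite /ball_ /= -ball_normE /= sub0r normrN.
rewrite dE normcE_norm ltcR => /(_ wd).
move=> h; set D := 'D_1 (k : R[i]^o -> R[i]^o) z.
have {h} : `|k w - k z - D * (w - z)| <= (e%:C)%C * (normc (w - z))%:C%C.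
  move: h; congr (`| _ | <= _).
  rewrite -![(_ + _ : _ -> _) _]/(_ + _) -![(- _ : _ -> _) _]/(- _) /cst /=.
  rewrite -[(w - z) *: 1]/((w - z) * 1) mulr1 subrK opprD addrA.
  by rewrite -[(w - z) *: D]/((w - z) * D) [D * _]mulrC.
by rewrite !normcE_norm -[(_)%:C%C * _]rmorphM /= lecR.
Qed.

Lemma cdiff_continuous k z : cdiff k z -> forall e : R, 0 < e ->
  exists2 d : R, 0 < d & forall w, normc (w - z) < d -> normc (k w - k z) < e.
Proof.
move=> [c hc] e e0; have [d d0 hd] := hc 1 ltr01.
have n0 := normc_ge0 c.
have m0 : 0 < e / (normc c + 2) by rewrite divr_gt0//; lra.
exists (Num.min d (e / (normc c + 2))); first by rewrite lt_min d0.
move=> w; rewrite lt_min ltr_pdivlMr; last lra.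
move=> /andP[/hd + h2]; rewrite mul1r => h1.
have -> : k w - k z = (k w - k z - c * (w - z)) + c * (w - z) by rewrite subrK.
apply: le_lt_trans (le_normcD _ _) _; rewrite normcM.
have := normc_ge0 (w - z); nra.
Qed.

Lemma cdiff_path_continuous k (g : R[i] -> R) (p : R -> R[i]) :
  (forall z w, `|g z - g w| <= normc (z - w)) ->
  (forall s t, normc (p s - p t) = `|s - t|) ->
  (forall z, cdiff k z) -> continuous (fun t => g (k (p t))).
Proof.
move=> hg hp hk t; apply/cvgrPdist_lt => e e0.
have [d d0 hd] := cdiff_continuous (hk (p t)) e0.
near=> s; rewrite distrC; apply: le_lt_trans (hg _ _) _; apply: hd; rewrite hp.
near: s; apply/nbhs_ballP; exists d => //= s.
by rewrite /ball /= distrC.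
Unshelve. all: by end_near. Qed.

Lemma horizontal_path (y s t : R) :
  normc ((s +i* y)%C - (t +i* y)%C) = `|s - t|.
Proof. by rewrite /= subrr expr0n/= addr0 sqrtr_sqr. Qed.

Lemma vertical_path (x s t : R) :
  normc ((x +i* s)%C - (x +i* t)%C) = `|s - t|.
Proof. by rewrite /= subrr expr0n/= add0r sqrtr_sqr. Qed.

Lemma cdiff_slices k : (forall z, cdiff k z) ->
  [/\ forall y, continuous (fun x : R => complex.Re (k (x +i* y)%C)),
      forall y, continuous (fun x : R => complex.Im (k (x +i* y)%C)),
      forall x, continuous (fun y : R => complex.Re (k (x +i* y)%C)) &
      forall x, continuous (fun y : R => complex.Im (k (x +i* y)%C))].
Proof.
move=> hk; split=> u.
- apply: (cdiff_path_continuous (g := @complex.Re R) (p := fun x => (x +i* u)%C)) => //.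
    by move=> z w; rewrite -ReB; exact: normc_Re.
  exact: horizontal_path.
- apply: (cdiff_path_continuous (g := @complex.Im R) (p := fun x => (x +i* u)%C)) => //.
    by move=> z w; rewrite -ImB; exact: normc_Im.
  exact: horizontal_path.
- apply: (cdiff_path_continuous (g := @complex.Re R) (p := fun y => (u +i* y)%C)) => //.
    by move=> z w; rewrite -ReB; exact: normc_Re.
  exact: vertical_path.
- apply: (cdiff_path_continuous (g := @complex.Im R) (p := fun y => (u +i* y)%C)) => //.
    by move=> z w; rewrite -ImB; exact: normc_Im.
  exact: vertical_path.
Qed.
End complex_derivative.

(** * Cauchy-Goursat theorem for rectangles *)

Section goursat.
Context {R : realType}.
Variable k : R[i] -> R[i].
Hypothesis hk : forall z, cdiff k z.

(** The real part of the integral of k along the boundary of the rectangle [a,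
    a + w] x [b, b + h], counterclockwise. Real parts suffice because a
    constant factor in k can rotate any value onto the positive axis. *)
Definition contour (a b w h : R) : R :=
  integ (fun x => complex.Re (k (x +i* b)%C)) a (a + w)
  - integ (fun x => complex.Re (k (x +i* (b + h))%C)) a (a + w)
  - integ (fun y => complex.Im (k ((a + w) +i* y)%C)) b (b + h)
  + integ (fun y => complex.Im (k (a +i* y)%C)) b (b + h).

Lemma contour_split (a b w h : R) :
  contour a b (w + w) (h + h) = contour a b w h + contour (a + w) b w h
   + contour a (b + h) w h + contour (a + w) (b + h) w h.
Proof. by rewrite /contour !addrA /integ; ring. Qed.

(** At a point of differentiability k is affine up to e' times the distance;
    the affine part integrates to 0 around the rectangle, and the rest is at
    most e' times the diameter times the perimeter. *)
Lemma contour_local (w h p q e : R) : 0 <= w -> 0 <= h -> 0 < e ->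
  exists2 d : R, 0 < d & forall a b s : R, 0 < s < d ->
     a <= p <= a + w * s -> b <= q <= b + h * s ->
     `|contour a b (w * s) (h * s)| <= e * s ^+ 2.
Proof.
move=> w0 h0 e0.
have [cRx _ _ cIy] := cdiff_slices hk.
have [c hc] := hk (p +i* q)%C.
(* The final bound is e' times diameter times perimeter, at most 2 e' (w +
   h)^2 s^2; the 1 keeps the denominator positive. *)
pose e' := e / (2 * (w + h) ^+ 2 + 1).
have D0 : 0 < 2 * (w + h) ^+ 2 + 1 by have := sqr_ge0 (w + h); lra.
have e'0 : 0 < e' by rewrite divr_gt0.
have eE : e = e' * (2 * (w + h) ^+ 2 + 1) by rewrite divfK// gt_eqF.
have [d d0 hd] := hc e' e'0.
have wh0 : 0 < w + h + 1 by lra.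
exists (d / (w + h + 1)) => [|a b s]; first by rewrite divr_gt0.
rewrite ltr_pdivlMr// => /andP[s0 sd] /andP[ap pa] /andP[bq qb].
case: c => c1 c2 in hc hd.
have W0 : 0 <= w * s by nra.
have H0 : 0 <= h * s by nra.
set W := w * s in pa W0 *; set H := h * s in qb H0 *.
pose E := e' * (W + H).
set u0 := complex.Re (k (p +i* q)%C); set v0 := complex.Im (k (p +i* q)%C).
(* Cauchy-Riemann: the affine part of k has derivatives c1, - c2 (real part)
   and c2, c1 (imaginary part). *)
have key x y : a <= x <= a + W -> b <= y <= b + H ->
  `|complex.Re (k (x +i* y)%C) - (u0 + c1 * (x - p) - c2 * (y - q))| <= E /\
  `|complex.Im (k (x +i* y)%C) - (v0 + c2 * (x - p) + c1 * (y - q))| <= E.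
  move=> /andP[x1 x2] /andP[y1 y2].
  have nb : normc ((x +i* y)%C - (p +i* q)%C) <= W + H.
    apply: le_trans (normc_le_ReIm _) _ => /=.
    by apply: lerD; rewrite ler_norml; lra.
  have nd : normc ((x +i* y)%C - (p +i* q)%C) < d.
    by apply: le_lt_trans nb _; rewrite /W /H; nra.
  have := hd _ nd => hE.
  have {}hE := le_trans hE (ler_wpM2l (ltW e'0) nb).
  split.
    apply: le_trans hE; apply: le_trans (normc_Re _).
    rewrite !ReB /= -/u0 le_eqVlt; apply/orP; left; apply/eqP; congr `|_|; ring.
  apply: le_trans hE; apply: le_trans (normc_Im _).
  rewrite !ImB /= -/v0 le_eqVlt; apply/orP; left; apply/eqP; congr `|_|; ring.
have aW : a <= a + W by lra.
have bH : b <= b + H by lra.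
have B1 := @integ_near_affine R (fun x => complex.Re (k (x +i* b)%C)) a (a + W)
  (u0 - c1 * p - c2 * (b - q)) c1 E aW (cRx b).
have B2 := @integ_near_affine R (fun x => complex.Re (k (x +i* (b + H))%C)) a (a + W)
  (u0 - c1 * p - c2 * (b + H - q)) c1 E aW (cRx (b + H)).
have B3 := @integ_near_affine R (fun y => complex.Im (k ((a + W) +i* y)%C)) b (b + H)
  (v0 + c2 * (a + W - p) - c1 * q) c1 E bH (cIy (a + W)).
have B4 := @integ_near_affine R (fun y => complex.Im (k (a +i* y)%C)) b (b + H)
  (v0 + c2 * (a - p) - c1 * q) c1 E bH (cIy a).
have {B1} : `|integ (fun x => complex.Re (k (x +i* b)%C)) a (a + W) -
    ((u0 - c1 * p - c2 * (b - q)) * (a + W - a) +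
     c1 / 2 * ((a + W) ^+ 2 - a ^+ 2))| <= E * (a + W - a).
  apply: B1 => x hx; have [|h1 _] := key x b hx; first lra.
  by apply: le_trans h1; rewrite le_eqVlt; apply/orP; left; apply/eqP; congr `|_|; ring.
have {B2} : `|integ (fun x => complex.Re (k (x +i* (b + H))%C)) a (a + W) -
    ((u0 - c1 * p - c2 * (b + H - q)) * (a + W - a) +
     c1 / 2 * ((a + W) ^+ 2 - a ^+ 2))| <= E * (a + W - a).
  apply: B2 => x hx; have [|h1 _] := key x (b + H) hx; first lra.
  by apply: le_trans h1; rewrite le_eqVlt; apply/orP; left; apply/eqP; congr `|_|; ring.
have {B3} : `|integ (fun y => complex.Im (k ((a + W) +i* y)%C)) b (b + H) -
    ((v0 + c2 * (a + W - p) - c1 * q) * (b + H - b) +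
     c1 / 2 * ((b + H) ^+ 2 - b ^+ 2))| <= E * (b + H - b).
  apply: B3 => y hy; have [|_ h1] := key (a + W) y _ hy; first lra.
  by apply: le_trans h1; rewrite le_eqVlt; apply/orP; left; apply/eqP; congr `|_|; ring.
have {B4} : `|integ (fun y => complex.Im (k (a +i* y)%C)) b (b + H) -
    ((v0 + c2 * (a - p) - c1 * q) * (b + H - b) +
     c1 / 2 * ((b + H) ^+ 2 - b ^+ 2))| <= E * (b + H - b).
  apply: B4 => y hy; have [|_ h1] := key a y _ hy; first lra.
  by apply: le_trans h1; rewrite le_eqVlt; apply/orP; left; apply/eqP; congr `|_|; ring.
rewrite /contour; move: (integ _ _ _) (integ _ _ _) (integ _ _ _) (integ _ _ _).
move=> X1 X2 X3 X4.
have EE : E * W + E * W + E * H + E * H <= e * s ^+ 2.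
  by rewrite eE /E /W /H; have := sqr_ge0 s; nra.
rewrite !ler_norml => /andP[b1 b1'] /andP[b2 b2'] /andP[b3 b3'] /andP[b4 b4'].
apply/andP; split; lra.
Qed.

(** The contour integral is additive under splitting into quarters and, by
    [contour_local], small compared with the square of the scale near every
    point. *)
Lemma goursat (a b w h : R) : 0 <= w -> 0 <= h -> contour a b w h = 0.
Proof.
move=> w0 h0.
have := @bisection_vanish R (fun a b s => contour a b (w * s) (h * s)) w h w0 h0.
move=> /(_ _ _ a b); rewrite !mulr1; apply.
  move=> x y s s0.
  rewrite -(mulrA w) -(mulrA h).
  have -> : w * s = w * (s / 2) + w * (s / 2) by field.
  have -> : h * s = h * (s / 2) + h * (s / 2) by field.
  rewrite contour_split.
  apply: le_trans (ler_normD _ _) _; rewrite lerD2r.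
  apply: le_trans (ler_normD _ _) _; rewrite lerD2r.
  exact: ler_normD.
move=> p q e e0; exact: contour_local.
Qed.
End goursat.

(** * A function of one complex variable that vanishes on the real axis *)

Section vanishing.
Context {R : realType}.
Implicit Types g : R[i] -> R[i].

Lemma cdiff_path_bounded g (p : R -> R[i]) (a b : R) : a <= b ->
  (forall z, cdiff g z) -> (forall s t, normc (p s - p t) = `|s - t|) ->
  exists M : R, forall t, a <= t <= b -> normc (g (p t)) <= M.
Proof.
move=> ab hg hp.
have [c _ hc] := @EVT_max R (fun t => normc (g (p t))) a b ab
  (continuous_subspaceT (cdiff_path_continuous normc_lipschitz hp hg)).
by exists (normc (g (p c))) => t tab; apply: hc; rewrite in_itv.
Qed.

(** The powers of this kernel are real on the line Im z = 1 and concentrate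
    there at z = i. The radius 3 makes the kernel smaller than 7 / 9 on the
    vertical edges of [-3, 3] x [0, 1]. *)
Definition peak (z : R[i]) : R[i] := 1 - (z - 'i%C) ^+ 2 / 9%:R.

Lemma derivable_mul_peak g (c : R[i]) N :
  (forall z : R[i]^o, derivable (g : R[i]^o -> R[i]^o) z 1) ->
  forall z, cdiff (fun w => c * g w * peak w ^+ N) z.
Proof.
move=> hg z; apply: derivable_cdiff.
have -> : (fun w : R[i]^o => c * g w * peak w ^+ N) =
  ((c \*: (g : R[i]^o -> R[i]^o)) *
   ((cst (1 : R[i]^o) - 9%:R^-1 \*: ((id - cst ('i%C : R[i]^o)) ^+ 2)) ^+ N)).
  apply/funext => w; rewrite /peak -[RHS]/(_ * _).
  congr (_ * _).
  have fX (f : R[i]^o -> R[i]^o) n : (f ^+ n) w = (f w) ^+ n.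
    by elim: n => [|n IH] //; rewrite !exprS -IH.
  rewrite fX; congr (_ ^+ _); rewrite -[RHS]/(_ - _); congr (_ - _).
  by rewrite -[RHS]/(_ * _) fX mulrC.
apply: derivableM; first exact/derivableZ/hg.
apply: derivableX; apply: derivableB; first exact: derivable_cst.
apply: derivableZ; apply: derivableX; apply: derivableB; first exact: derivable_id.
exact: derivable_cst.
Qed.

Lemma peak_top (x : R) : peak (x +i* 1)%C = ((1 - x ^+ 2 / 9)%:C)%C.
Proof.
have e9 : 9%:R = ((9 : R)%:C)%C :> R[i] by rewrite rmorph_nat.
rewrite /peak e9 -fmorphV expr2 /=; apply/eqP; rewrite eq_complex /=.
by apply/andP; split; apply/eqP; field.
Qed.

(** On the lines x = 3 and x = -3 the kernel is (s^2 +/- 6 i s) / 9 with s = 1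
    - y in [0, 1], and its squared modulus is at most 37 / 81. *)
Lemma peak_side (x y : R) : x ^+ 2 = 9 -> 0 <= y <= 1 ->
  normc (peak (x +i* y)%C) <= 7 / 9.
Proof.
move=> x9 /andP[y0 y1].
have -> : peak (x +i* y)%C = (((1 - y) ^+ 2 / 9) +i* (2 * x * (1 - y) / 9))%C.
  have e9 : 9%:R = ((9 : R)%:C)%C :> R[i] by rewrite rmorph_nat.
  rewrite /peak e9 -fmorphV expr2 /=; apply/eqP; rewrite eq_complex /=.
  apply/andP; split; apply/eqP; last by field.
  have -> : (1 - y) ^+ 2 / 9 = 1 - (x ^+ 2 - (1 - y) ^+ 2) / 9 by rewrite x9; field.
  by field.
rewrite /= -[leRHS]ger0_norm; last by lra.
rewrite -sqrtr_sqr ler_wsqrtr//.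
have -> : ((1 - y) ^+ 2 / 9) ^+ 2 + (2 * x * (1 - y) / 9) ^+ 2 =
  ((1 - y) ^+ 4 + 36 * (1 - y) ^+ 2) / 81.
  have -> : (2 * x * (1 - y) / 9) ^+ 2 = 4 * x ^+ 2 * (1 - y) ^+ 2 / 81 by field.
  by rewrite x9; field.
have h : (1 - y) ^+ 2 <= 1 by rewrite expr_le1//; lra.
have h4 : (1 - y) ^+ 4 <= 1 by rewrite expr_le1//; lra.
lra.
Qed.

Lemma expr_small (r e : R) : 0 <= r < 1 -> 0 < e -> exists N, r ^+ N < e.
Proof.
move=> /andP[r0 r1] e0.
have : (fun k => r ^+ k) @ \oo --> (0 : R) by apply: cvg_expr; rewrite ger0_norm.
move=> /cvgrPdist_lt /(_ e e0) [N _ /(_ N (leqnn N))] /=.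
by rewrite sub0r normrN ger0_norm ?exprn_ge0//; exists N.
Qed.

(** Take d <= 1 with F >= F 0 / 2 on [-d, d]. The part |x| <= d / 2
    contributes at least a multiple of (1 - d^2 / 36)^N, whereas the negative
    part of the integrand lives on |x| >= d and is bounded by a multiple of (1
    - d^2 / 9)^N; the rate 7 / 9 is at most 1 - d^2 / 9 as well. *)
Lemma peak_concentration (F : R -> R) (M : R) : continuous F -> 0 < F 0 ->
  (forall x : R, -3 <= x <= 3 -> `|F x| <= M) ->
  exists N, 2 * M * (7 / 9) ^+ N <
    integ (fun x => F x * (1 - x ^+ 2 / 9) ^+ N) (-3) 3.
Proof.
move=> cF F0 FM.
pose c := F 0 / 2; have c0 : 0 < c by rewrite /c; lra.
have [d /andP[d0 d1] hd] : exists2 d : R, 0 < d <= 1 & forall x : R, `|x| <= d -> c <= F x.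
  have /cvgrPdist_lt /(_ c c0) /nbhs_ballP [d /= d0 hd] := cF 0.
  exists (Num.min (d / 2) 1).
    by rewrite lt_min ltr01 divr_gt0//= ge_min lexx orbT.
  move=> x; rewrite le_min => /andP[xd _].
  have : `|F 0 - F x| < c.
    by apply: hd; rewrite /ball /= sub0r normrN (le_lt_trans xd)//; lra.
  by rewrite ltr_norml /c => /andP[_]; lra.
have M0 : 0 <= M by apply: le_trans (normr_ge0 _) (FM 0 _); lra.
(* The smallest value of the kernel on |x| <= d / 2 and the largest one on d
   <= |x| <= 3. *)
pose r1 := 1 - (d / 2) ^+ 2 / 9; pose r2 := 1 - d ^+ 2 / 9.
have d2 : d ^+ 2 <= 1 by rewrite expr_le1// ltW.
have d2' : 0 < d ^+ 2 by rewrite exprn_gt0.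
have r1E : r1 = 1 - d ^+ 2 / 36 by rewrite /r1; field.
have r10 : 0 < r1 by rewrite r1E; lra.
have r20 : 0 < r2 by rewrite /r2; lra.
have r21 : r2 < r1 by rewrite r1E /r2; lra.
have [||N hN] := @expr_small (r2 / r1) (c * d / (8 * M + 1)).
- by rewrite divr_ge0 ?ltW//= ltr_pdivrMr// mul1r.
- by rewrite divr_gt0 ?mulr_gt0//; lra.
exists N.
set f := (fun x : R => F x * (1 - x ^+ 2 / 9) ^+ N).
have cf : continuous f.
  move=> x; apply: (@continuousM R R F (fun x => (1 - x ^+ 2 / 9) ^+ N)); first exact: cF.
  apply: (continuous_comp (f := fun x : R => 1 - x ^+ 2 / 9) (g := fun y => y ^+ N)); last exact: exprn_continuous.
  apply: cvgB; first exact: cvg_cst.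
  by apply: cvgMr_tmp; exact: exprn_continuous.
have kpos (x : R) : -3 <= x <= 3 -> 0 <= 1 - x ^+ 2 / 9 by nra.
have out (x : R) : -3 <= x <= 3 -> d <= `|x| -> - (M * r2 ^+ N) <= f x.
  move=> x3 dx.
  have kle : 1 - x ^+ 2 / 9 <= r2.
    rewrite /r2 -(real_normK (num_real x)).
    have : d ^+ 2 <= `|x| ^+ 2 by rewrite lerXn2r ?nnegrE ?(ltW d0).
    by lra.
  have kN : (1 - x ^+ 2 / 9) ^+ N <= r2 ^+ N.
    by apply: lerXn2r; rewrite ?nnegrE; [exact: kpos|exact: ltW|exact: kle].
  have k0 : 0 <= (1 - x ^+ 2 / 9) ^+ N by rewrite exprn_ge0// kpos.
  have := FM x x3; rewrite ler_norml => /andP[h _]; rewrite /f; nra.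
have near0 (x : R) : `|x| <= d -> 0 <= f x.
  move=> xd; rewrite mulr_ge0//; first by apply: le_trans (hd x xd); exact: ltW.
  by rewrite exprn_ge0// kpos//; move: xd; rewrite ler_norml; lra.
have center (x : R) : `|x| <= d / 2 -> c * r1 ^+ N <= f x.
  move=> xd; have xd' : `|x| <= d by lra.
  apply: ler_pM; [exact: ltW|exact/exprn_ge0/ltW|exact: hd|].
  rewrite lerXn2r ?nnegrE ?(ltW r10)//.
    by apply: kpos; move: xd'; rewrite ler_norml; lra.
  rewrite /r1 -(real_normK (num_real x)).
  have : `|x| ^+ 2 <= (d / 2) ^+ 2 by rewrite lerXn2r ?nnegrE//; lra.
  by lra.
rewrite -(integ_cat f (-3) (-d) 3) -(integ_cat f (-d) (-(d / 2)) 3).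
rewrite -(integ_cat f (-(d / 2)) (d / 2) 3) -(integ_cat f (d / 2) d 3).
have [|x1 hx1 ->] := @integ_mean R f (-3) (-d) _ cf; first lra.
have [|x2 hx2 ->] := @integ_mean R f (-d) (-(d/2)) _ cf; first lra.
have [|x3 hx3 ->] := @integ_mean R f (-(d/2)) (d/2) _ cf; first lra.
have [|x4 hx4 ->] := @integ_mean R f (d/2) d _ cf; first lra.
have [|x5 hx5 ->] := @integ_mean R f d 3 _ cf; first lra.
have f1 : - (M * r2 ^+ N) <= f x1.
  by apply: out; [lra|rewrite ler0_norm; lra].
have f2 : 0 <= f x2 by apply: near0; rewrite ler_norml; lra.
have f3 : c * r1 ^+ N <= f x3 by apply: center; rewrite ler_norml; lra.
have f4 : 0 <= f x4 by apply: near0; rewrite ler_norml; lra.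
have f5 : - (M * r2 ^+ N) <= f x5.
  by apply: out; [lra|rewrite ger0_norm; lra].
have R1 : 0 < r1 ^+ N by rewrite exprn_gt0.
have R2 : 0 < r2 ^+ N by rewrite exprn_gt0.
have R3 : (7 / 9) ^+ N <= r2 ^+ N.
  by rewrite lerXn2r ?nnegrE ?(ltW r20)//; rewrite ?/r2; lra.
have key : r2 ^+ N * (8 * M + 1) < c * d * r1 ^+ N.
  move: hN; rewrite expr_div_n ltr_pdivlMr; last lra.
  by rewrite mulrAC ltr_pdivrMr.
have g1 : - (3 * (M * r2 ^+ N)) <= f x1 * (- d - -3).
  have : 0 <= M * r2 ^+ N by rewrite mulr_ge0// ltW.
  by nra.
have g5 : - (3 * (M * r2 ^+ N)) <= f x5 * (3 - d).
  have : 0 <= M * r2 ^+ N by rewrite mulr_ge0// ltW.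
  by nra.
have g2 : 0 <= f x2 * (- (d / 2) - - d) by rewrite mulr_ge0//; lra.
have g4 : 0 <= f x4 * (d - d / 2) by rewrite mulr_ge0//; lra.
have g3 : c * r1 ^+ N * d <= f x3 * (d / 2 - - (d / 2)).
  have -> : d / 2 - - (d / 2) = d by field.
  by rewrite ler_wpM2r// ltW.
have g6 : 2 * M * (7 / 9) ^+ N <= 2 * M * r2 ^+ N.
  by rewrite ler_wpM2l//; lra.
have : r2 ^+ N * (8 * M + 1) = 8 * (M * r2 ^+ N) + r2 ^+ N by ring.
have : c * d * r1 ^+ N = c * r1 ^+ N * d by ring.
have : 2 * M * r2 ^+ N = 2 * (M * r2 ^+ N) by ring.
lra.
Qed.

(** By [goursat] the integrals over the four edges of [-3, 3] x [0, 1] cancel. *)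
Lemma top_edge_bound (k : R[i] -> R[i]) (E : R) :
  (forall z, cdiff k z) -> (forall x, k (x +i* 0)%C = 0) ->
  (forall x y : R, x = -3 \/ x = 3 -> 0 <= y <= 1 ->
     `|complex.Im (k (x +i* y)%C)| <= E) ->
  integ (fun x => complex.Re (k (x +i* 1)%C)) (-3) 3 <= 2 * E.
Proof.
move=> hk k0 side; have [cR _ _ cI] := cdiff_slices hk.
have m33 : -3 <= 3 :> R by lra.
have six : 0 <= 6 :> R by lra.
have bottom : integ (fun x => complex.Re (k (x +i* 0)%C)) (-3) 3 = 0.
  by have [x0 _ ->] := integ_mean m33 (cR 0); rewrite k0 mul0r.
have [y1 hy1 right_edge] := integ_mean (@ler01 R) (cI 3).
have [y2 hy2 left_edge] := integ_mean (@ler01 R) (cI (-3)).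
have := goursat hk (-3) 0 six (@ler01 R).
rewrite /contour (_ : -3 + 6 = 3 :> R); last ring.
rewrite add0r bottom right_edge left_edge.
have := side 3 y1 (or_intror erefl) hy1.
have := side (-3) y2 (or_introl erefl) hy2.
rewrite !subr0 !mulr1 !ler_norml; lra.
Qed.

(** If g(i) is not 0, the real part of conj(g(i)) g is positive at i. The
    contour integral of conj(g(i)) g peak^N vanishes, which equates the
    integral over the top edge, bounded below by [peak_concentration], with
    the integrals over the vertical edges, at most M (7 / 9)^N each. *)
Lemma vanish_at_i g :
  (forall z : R[i]^o, derivable (g : R[i]^o -> R[i]^o) z 1) ->
  (forall x : R, g (x +i* 0)%C = 0) -> g 'i%C = 0.
Proof.
move=> hg g0; apply: contrapT => /eqP gi.
(* The factor c makes the value at i equal to |g(i)|^2 > 0. *)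
pose c := conjc (g 'i%C).
pose k N w := c * g w * peak w ^+ N.
have kd N z : cdiff (k N) z by exact: derivable_mul_peak.
have Gd z : cdiff (fun w => c * g w) z.
  have := kd 0%N z; congr (cdiff _ z); apply/funext => w.
  by rewrite /k expr0 mulr1.
pose F x := complex.Re (c * g (x +i* 1)%C).
have F0 : 0 < F 0.
  rewrite /F /c; move: gi; rewrite eq_complex negb_and; case: (g 'i%C) => a b /=.
  rewrite mulNr opprK -!expr2 => /orP[h|h].
    by rewrite ltr_pwDl ?sqr_ge0// lt_def sqr_ge0 sqrf_eq0 h.
  by rewrite ltr_wpDl ?sqr_ge0// lt_def sqr_ge0 sqrf_eq0 h.
have [cF _ _ _] := cdiff_slices Gd.
have m33 : -3 <= 3 :> R by lra.
have [M1 hM1] := cdiff_path_bounded m33 Gd (horizontal_path 1).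
have [M2 hM2] := cdiff_path_bounded (@ler01 R) Gd (vertical_path (-3)).
have [M3 hM3] := cdiff_path_bounded (@ler01 R) Gd (vertical_path 3).
pose M := Num.max M1 (Num.max M2 M3).
have [|N] := @peak_concentration F M (cF 1) F0.
  move=> x hx; apply: le_trans (normc_Re _) _; apply: le_trans (hM1 x hx) _.
  by rewrite le_max lexx.
have side x y : x = -3 \/ x = 3 -> 0 <= y <= 1 ->
    `|complex.Im (k N (x +i* y)%C)| <= M * (7 / 9) ^+ N.
  move=> hx hy; apply: le_trans (normc_Im _) _; rewrite /k normcM normcX.
  apply: ler_pM; rewrite ?exprn_ge0 ?normc_ge0//.
    case: hx => ->; [apply: le_trans (hM2 y hy) _|apply: le_trans (hM3 y hy) _].
      by rewrite !le_max lexx orbT.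
    by rewrite !le_max lexx !orbT.
  apply: lerXn2r; rewrite ?nnegrE ?normc_ge0//.
  by apply: peak_side => //; case: hx => ->; ring.
have top : (fun x => complex.Re (k N (x +i* 1)%C)) =
    (fun x => F x * (1 - x ^+ 2 / 9) ^+ N).
  apply/funext => x; rewrite /k peak_top -rmorphXn /F.
  by case: (c * _) => a b /=; ring.
have bottom x : k N (x +i* 0)%C = 0 by rewrite /k g0 mulr0 mul0r.
have := top_edge_bound (kd N) bottom side.
by rewrite top mulrA leNgt => /negP.
Qed.
End vanishing.

(** * Entire functions are determined by their real values *)

Section real_uniqueness.
Context {R : realType} {n : nat}.
Implicit Types G : 'rV[R[i]]_n -> R[i].

(** The point x + i y lies at parameter i on the complex line through x in the
    real direction y, along which G is a function of one complex variable that
    vanishes at real parameters. *)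
Lemma entire_eq0 G : entire G -> (forall x, G (real_to_complexV x) = 0) ->
  forall z, G z = 0.
Proof.
move=> eG G0 z.
pose X : 'rV[R[i]]_n := \row_i (complex.Re (z 0 i))%:C%C.
pose Y : 'rV[R[i]]_n := \row_i (complex.Im (z 0 i))%:C%C.
pose g (w : R[i]) := G (X + w *: Y).
have -> : G z = g 'i%C.
  congr G; apply/rowP => j; rewrite !mxE; case: (z 0 j) => a b /=.
  by apply/eqP; rewrite eq_complex /=; apply/andP; split; apply/eqP; ring.
apply: vanish_at_i => [w|x].
  have H := @diff_derivable _ _ _ _ _ Y (eG (X + w *: Y)).
  rewrite /derivable.
  suff -> : (fun h : R[i] => h^-1 *: ((((g : R[i]^o -> R[i]^o) \o shift w) (h *: 1) : R[i]^o)
      - g w)) = (fun h : R[i] => h^-1 *: (((G \o shift (X + w *: Y)) (h *: Y) : R[i]^o)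
      - G (X + w *: Y))) by exact: H.
  apply/funext => h /=; congr (_ *: (_ - _)); rewrite /g; congr G.
  by rewrite -[h *: 1]/(h * 1) mulr1 scalerDl addrCA.
rewrite /g -(G0 (\row_i (complex.Re (z 0 i) + x * complex.Im (z 0 i)))).
congr G; apply/rowP => j; rewrite !mxE.
by apply/eqP; rewrite eq_complex /=; apply/andP; split; apply/eqP; ring.
Qed.

Lemma entire_extension_unique (f : 'rV[R]_n -> R[i]) F1 F2 :
  entire_extension f F1 -> entire_extension f F2 -> F1 = F2.
Proof.
move=> [e1 h1] [e2 h2]; apply/funext => z; apply/eqP; rewrite -subr_eq0; apply/eqP.
apply: (@entire_eq0 (fun z => F1 z - F2 z)) => [w|x].
  exact: (differentiableB (e1 w) (e2 w)).
by rewrite h1 h2 subrr.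
Qed.
End real_uniqueness.

(** * Multiple series summed over boxes *)

Section box_sums.
Context {n : nat}.
Notation multi := ('I_n -> nat).
Implicit Types (l : seq 'I_n) (al : multi).

Definition upd al (i : 'I_n) (a : nat) : multi :=
  fun j => if j == i then a else al j.

Definition supported l al := forall i, i \notin l -> al i = 0%N.

(** Nested, so that induction on the list of coordinates meets a one-variable
    sum at each step; coordinates outside l keep the exponent 0. *)
Fixpoint bsum {V : nmodType} (N : nat) l (t : multi -> V) : V :=
  if l is i :: l' then \sum_(a < N) bsum N l' (fun al => t (upd al i a))
  else t (fun=> 0%N).

Definition mdeg l al : nat := (\sum_(i <- l) al i)%N.

Lemma supported_upd l al i a : supported l al -> supported (i :: l) (upd al i a).
Proof.
move=> h j; rewrite inE negb_or /upd => /andP[/negbTE -> jl]; exact: h.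
Qed.

Lemma mdeg_upd l al i a : i \notin l -> mdeg (i :: l) (upd al i a) = (a + mdeg l al)%N.
Proof.
move=> il; rewrite /mdeg big_cons {1}/upd eqxx; congr addn.
apply: eq_big_seq => j jl; rewrite /upd; case: eqP => // ji.
by rewrite -ji jl in il.
Qed.

Lemma bsum_eq {V : nmodType} N l (t t' : multi -> V) :
  (forall al, supported l al -> t al = t' al) -> bsum N l t = bsum N l t'.
Proof.
elim: l t t' => [|i l IH] t t' h /=; first exact: h.
by apply: eq_bigr => a _; apply: IH => al hal; apply/h/supported_upd.
Qed.

Lemma bsum_morph {V W : nmodType} (f : V -> W) N l (t : multi -> V) :
  f 0 = 0 -> {morph f : x y / x + y} ->
  f (bsum N l t) = bsum N l (fun al => f (t al)).
Proof.
move=> f0 fD; elim: l t => [|i l IH] t //=.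
by rewrite (big_morph f fD f0); apply: eq_bigr => a _; exact: IH.
Qed.

Lemma bsumD {V : nmodType} N l (t t' : multi -> V) :
  bsum N l (fun al => t al + t' al) = bsum N l t + bsum N l t'.
Proof.
elim: l t t' => [|i l IH] t t' //=.
by rewrite -big_split; apply: eq_bigr => a _ /=; rewrite IH.
Qed.

Lemma bsum_sum {V : nmodType} N l m (t : 'I_m -> multi -> V) :
  bsum N l (fun al => \sum_(a < m) t a al) = \sum_(a < m) bsum N l (t a).
Proof.
elim: l t => [|i l IH] t //=.
by rewrite exchange_big; apply: eq_bigr => a _ /=; rewrite IH.
Qed.

Lemma bsumZ {A : pzRingType} N l (c : A) (t : multi -> A) :
  bsum N l (fun al => c * t al) = c * bsum N l t.
Proof.
by rewrite (@bsum_morph _ _ (fun x => c * x)) ?mulr0// => x y; rewrite mulrDr.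
Qed.

End box_sums.

Section box_sum_bounds.
Context {R : realType} {n : nat}.
Notation multi := ('I_n -> nat).
Implicit Types (l : seq 'I_n) (al : multi).

Definition geom (N : nat) (q : R) : R := \sum_(a < N) q ^+ a.

Lemma bsum_geom N l q : uniq l ->
  bsum N l (fun al => q ^+ mdeg l al) = geom N q ^+ size l.
Proof.
elim: l => [|i l IH] /=; first by rewrite /mdeg big_nil.
move=> /andP[il ul]; rewrite exprS /geom mulr_suml; apply: eq_bigr => a _.
rewrite -/(geom N q) -IH// -bsumZ; apply: bsum_eq => al _.
by rewrite mdeg_upd// exprD.
Qed.

Lemma geomE N (q : R) : geom N q * (1 - q) = 1 - q ^+ N.
Proof.
elim: N => [|N IH]; first by rewrite /geom big_ord0 expr0 mul0r subrr.
by rewrite /geom big_ord_recr/= -/(geom N q) mulrDl IH exprSr; ring.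
Qed.

Lemma geom_ge0 N (q : R) : 0 <= q -> 0 <= geom N q.
Proof. by move=> q0; apply: sumr_ge0 => a _; exact: exprn_ge0. Qed.

Lemma geom_le N (q : R) : 0 <= q < 1 -> geom N q <= (1 - q)^-1.
Proof.
move=> /andP[q0 q1]; have q2 : 0 < 1 - q by lra.
rewrite -[leRHS]mul1r ler_pdivlMr// geomE.
by have := exprn_ge0 N q0; lra.
Qed.

Lemma normc_sum m (F : 'I_m -> R[i]) :
  normc (\sum_(a < m) F a) <= \sum_(a < m) normc (F a).
Proof.
elim: m F => [|m IH] F; first by rewrite !big_ord0 normc0.
rewrite !big_ord_recr /=; apply: le_trans (le_normcD _ _) _.
by rewrite lerD2r; exact: IH.
Qed.

Lemma bsum_normc_le N l (t : multi -> R[i]) (s : multi -> R) :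
  (forall al, supported l al -> normc (t al) <= s al) ->
  normc (bsum N l t) <= bsum N l s.
Proof.
elim: l t s => [|i l IH] t s h /=; first exact: h.
apply: le_trans (normc_sum _) _; apply: ler_sum => a _.
by apply: IH => al hal; apply/h/supported_upd.
Qed.

(** Passing from the box N to the box N.+1 only adds terms; comparing the
    added terms one by one makes the increments of a dominated sum at most
    those of its majorant. *)
Lemma bsum_step_le N l (t : multi -> R[i]) (s : multi -> R) :
  (forall al, supported l al -> normc (t al) <= s al) ->
  normc (bsum N.+1 l t - bsum N l t) <= bsum N.+1 l s - bsum N l s.
Proof.
elim: l t s => [|i l IH] t s h /=; first by rewrite !subrr normc0.
rewrite !big_ord_recr /= addrAC -sumrB [leRHS]addrAC -sumrB.
apply: le_trans (le_normcD _ _) _; apply: lerD.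
  apply: le_trans (normc_sum _) _; apply: ler_sum => a _.
  by apply: IH => al hal; apply/h/supported_upd.
by apply: bsum_normc_le => al hal; apply/h/supported_upd.
Qed.

End box_sum_bounds.

Section multiple_series.
Context {R : realType} {n : nat}.
Notation multi := ('I_n -> nat).
Implicit Types (t : multi -> R[i]) (S : nat -> R[i]).

Definition deg (al : multi) : nat := (\sum_(i < n) al i)%N.

Lemma mdeg_enum al : mdeg (enum 'I_n) al = deg al.
Proof. by rewrite /mdeg big_enum. Qed.

(** Boxes exhaust all multi-indices as N grows. *)
Definition psum N t := bsum N (enum 'I_n) t.

Definition cvgC S (L : R[i]) := forall e : R, 0 < e ->
  exists N0, forall N, (N0 <= N)%N -> normc (S N - L) < e.

Definition geom_dominated (M q : R) t :=
  forall al, normc (t al) <= M * q ^+ deg al.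

(** The limits are meaningful for [csummable] terms, see [csummableP]. *)
Definition csum t : R[i] :=
  (limn (fun N => complex.Re (psum N t)) +i*
   limn (fun N => complex.Im (psum N t)))%C.

Lemma cvgC_unique S L L' : cvgC S L -> cvgC S L' -> L = L'.
Proof.
move=> h h'; apply/eqP; rewrite -subr_eq0; apply/eqP; apply: eq0_normc.
apply/eqP; rewrite eq_le normc_ge0 andbT; apply/ler_addgt0Pl => e e0; rewrite addr0.
have e2 : 0 < e / 2 by rewrite divr_gt0.
have [N1 h1] := h _ e2; have [N2 h2] := h' _ e2.
have := h1 (maxn N1 N2) (leq_maxl _ _); have := h2 (maxn N1 N2) (leq_maxr _ _).
set s := S _ => a b.
have -> : L - L' = (s - L') - (s - L) by ring.
apply: le_trans (le_normcD _ _) _; rewrite normcN; lra.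
Qed.

Lemma cvgC_lin S S' L L' (c c' : R[i]) : cvgC S L -> cvgC S' L' ->
  cvgC (fun N => c * S N + c' * S' N) (c * L + c' * L').
Proof.
move=> h h' e e0; have n1 := normc_ge0 c; have n2 := normc_ge0 c'.
pose d := e / (normc c + normc c' + 1).
have D0 : 0 < normc c + normc c' + 1 by lra.
have d0 : 0 < d by rewrite divr_gt0.
have eE : e = d * (normc c + normc c' + 1) by rewrite divfK// gt_eqF.
have [N1 h1] := h _ d0; have [N2 h2] := h' _ d0.
exists (maxn N1 N2) => N; rewrite geq_max => /andP[/h1 k1 /h2 k2].
have -> : c * S N + c' * S' N - (c * L + c' * L') =
  c * (S N - L) + c' * (S' N - L') by ring.
apply: le_lt_trans (le_normcD _ _) _; rewrite !normcM eE.
have := normc_ge0 (S N - L); have := normc_ge0 (S' N - L'); nra.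
Qed.

Lemma cvgC_le S L (B : R) : cvgC S L -> (forall N, normc (S N) <= B) -> normc L <= B.
Proof.
move=> h hB; apply/ler_addgt0Pl => e e0; have [N0 h0] := h e e0.
have := h0 N0 (leqnn _); have := hB N0.
have E : L = S N0 - (S N0 - L) by rewrite opprB addrC subrK.
move=> a b; rewrite E; apply: le_trans (le_normcD _ _) _; rewrite normcN; lra.
Qed.

Lemma psum_bound N M q t : 0 <= M -> 0 <= q < 1 -> geom_dominated M q t ->
  normc (psum N t) <= M * (1 - q)^-1 ^+ n.
Proof.
move=> M0 q01 h; rewrite /psum.
apply: le_trans (bsum_normc_le (s := fun al => M * q ^+ mdeg (enum 'I_n) al) _ _) _.
  by move=> al _; rewrite mdeg_enum.
rewrite bsumZ bsum_geom ?enum_uniq// size_enum_ord ler_wpM2l//.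
have := q01 => /andP[q0 q1].
by apply: lerXn2r; rewrite ?nnegrE ?geom_ge0// ?invr_ge0 ?geom_le//; lra.
Qed.

(** Both A and x + A are nondecreasing and bounded. *)
Lemma dominated_steps_cvg (x A : nat -> R) (B : R) :
  (forall N, `|x N.+1 - x N| <= A N.+1 - A N) -> (forall N, A N <= B) ->
  (forall N, `|x N| <= B) -> cvgn x.
Proof.
move=> h hA hx.
have cA : cvgn A.
  apply: nondecreasing_is_cvgn.
    apply/nondecreasing_seqP => N; rewrite -subr_ge0.
    by apply: le_trans (normr_ge0 _) (h N).
  by exists B => _ [N _ <-].
have cxA : cvgn (x + A).
  apply: nondecreasing_is_cvgn.
    apply/nondecreasing_seqP => N; have := h N.
    by rewrite ler_norml -[(x + A) N]/(x N + A N) -[(x + A) N.+1]/(x N.+1 + A N.+1); lra.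
  exists (B + B) => _ [N _ <-]; rewrite -[(x + A) N]/(x N + A N) lerD//.
  by apply: le_trans (ler_norm _) (hx N).
have -> : x = (x + A) - A by rewrite addrK.
exact: is_cvgB.
Qed.

Lemma csumP M q t : 0 <= M -> 0 <= q < 1 -> geom_dominated M q t ->
  cvgC (fun N => psum N t) (csum t).
Proof.
move=> M0 q01 h.
pose A N := M * geom N q ^+ n.
have step N : normc (psum N.+1 t - psum N t) <= A N.+1 - A N.
  apply: le_trans (bsum_step_le (s := fun al => M * q ^+ mdeg (enum 'I_n) al) _ _) _.
    by move=> al _; rewrite mdeg_enum.
  by rewrite !bsumZ !bsum_geom ?enum_uniq// size_enum_ord.
have AB N : A N <= M * (1 - q)^-1 ^+ n.
  have := q01 => /andP[q0 q1]; rewrite ler_wpM2l//.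
  by apply: lerXn2r; rewrite ?nnegrE ?geom_ge0// ?invr_ge0 ?geom_le//; lra.
have SB N := psum_bound N M0 q01 h.
have cR : cvgn (fun N => complex.Re (psum N t)).
  apply: (dominated_steps_cvg (A := A) (B := M * (1 - q)^-1 ^+ n)) => // N.
    by rewrite -ReB; apply: le_trans (normc_Re _) (step N).
  by apply: le_trans (normc_Re _) (SB N).
have cI : cvgn (fun N => complex.Im (psum N t)).
  apply: (dominated_steps_cvg (A := A) (B := M * (1 - q)^-1 ^+ n)) => // N.
    by rewrite -ImB; apply: le_trans (normc_Im _) (step N).
  by apply: le_trans (normc_Im _) (SB N).
move=> e e0; have e2 : 0 < e / 2 by rewrite divr_gt0.
move/cvgrPdist_lt : cR => /(_ _ e2) [N1 _ h1].
move/cvgrPdist_lt : cI => /(_ _ e2) [N2 _ h2].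
exists (maxn N1 N2) => N; rewrite geq_max => /andP[/h1 k1 /h2 k2].
apply: le_lt_trans (normc_le_ReIm _) _; rewrite ReB ImB /=.
rewrite /= distrC in k1; rewrite /= distrC in k2; lra.
Qed.

Lemma csum_bound M q t : 0 <= M -> 0 <= q < 1 -> geom_dominated M q t ->
  normc (csum t) <= M * (1 - q)^-1 ^+ n.
Proof.
move=> M0 q01 h; apply: cvgC_le (csumP M0 q01 h) _ => N; exact: psum_bound.
Qed.

Definition csummable t := exists M q : R, [/\ 0 <= M, 0 <= q < 1 & geom_dominated M q t].

Lemma csummableP t : csummable t -> cvgC (fun N => psum N t) (csum t).
Proof. by move=> [M [q [? ? ?]]]; apply: csumP; eassumption. Qed.

Lemma csum_lin t t' c c' : csummable t -> csummable t' ->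
  csummable (fun al => c * t al + c' * t' al) ->
  csum (fun al => c * t al + c' * t' al) = c * csum t + c' * csum t'.
Proof.
move=> /csummableP h /csummableP h' /csummableP h''; apply: cvgC_unique h'' _.
have := cvgC_lin c c' h h'; congr cvgC; apply/funext => N.
by rewrite /psum bsumD !bsumZ.
Qed.

Lemma csummable_lin t t' c c' : csummable t -> csummable t' ->
  csummable (fun al => c * t al + c' * t' al).
Proof.
move=> [M [q [M0 /andP[q0 q1] h]]] [M' [q' [M0' /andP[q0' q1'] h']]].
exists (normc c * M + normc c' * M'), (Num.max q q'); split.
- by rewrite addr_ge0 ?mulr_ge0 ?normc_ge0.
- by rewrite le_max q0 gt_max q1.
move=> al; apply: le_trans (le_normcD _ _) _; rewrite !normcM mulrDl -!mulrA.
have m0 : 0 <= Num.max q q' by rewrite le_max q0.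
apply: lerD; apply: ler_wpM2l; rewrite ?normc_ge0//.
  apply: le_trans (h al) _; apply: ler_wpM2l => //.
  by apply: lerXn2r; rewrite ?nnegrE// le_max lexx.
apply: le_trans (h' al) _; apply: ler_wpM2l => //.
by apply: lerXn2r; rewrite ?nnegrE// le_max lexx orbT.
Qed.

End multiple_series.

(** * Entire power series in several variables *)

Section monomial_jets.
Context {R : realType} {n : nat}.
Notation multi := ('I_n -> nat).
Notation C := R[i].
Implicit Types (w h : 'rV[C]_n) (al : multi).

Definition mono w al : C := \prod_(i < n) w 0 i ^+ al i.

Definition coord_le h (eta : R) := 0 <= eta /\ forall i, normc (h 0 i) <= eta.

(** A first-order expansion of P at w with quadratic remainder. Value, linear
    part and remainder share one constant A, so that these expansions are
    easily multiplied, with a loss that is harmless for coefficients decaying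
    faster than every geometric sequence. *)
Definition jet w (A : R) (P l : 'rV[C]_n -> C) := [/\
  normc (P w) <= A,
  forall a h h', l (a *: h + h') = a * l h + l h',
  forall h eta, coord_le h eta -> normc (l h) <= A * eta &
  forall h eta, coord_le h eta -> eta <= 1 ->
    normc (P (w + h) - P w - l h) <= A * eta ^+ 2].

(** Each of the three parts of the product has at most two terms of size A (r
    + 1), whence the factor 2 (r + 1). *)
Lemma jet_mul_coord w A P l (r : R) i : normc (w 0 i) <= r -> jet w A P l ->
  exists l', jet w (A * (2 * (r + 1))) (fun z => P z * z 0 i) l'.
Proof.
move=> wr [P0 llin lle lrem].
have A0 : 0 <= A by apply: le_trans (normc_ge0 _) P0.
have r0 : 0 <= r by apply: le_trans (normc_ge0 _) wr.
exists (fun h => l h * w 0 i + P w * h 0 i); split.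
- rewrite normcM; apply: ler_pM; rewrite ?normc_ge0//; lra.
- by move=> a h h'; rewrite llin !mxE; ring.
- move=> h eta hh; have [e0 he] := hh.
  apply: le_trans (le_normcD _ _) _; rewrite !normcM.
  have h1 : normc (l h) * normc (w 0 i) <= A * eta * r.
    by apply: ler_pM; rewrite ?normc_ge0// lle.
  have h2 : normc (P w) * normc (h 0 i) <= A * eta.
    by apply: ler_pM; rewrite ?normc_ge0// he.
  have : 0 <= A * eta by rewrite mulr_ge0.
  have : 0 <= A * eta * r by rewrite !mulr_ge0.
  lra.
- move=> h eta hh e1; have [e0 he] := hh; rewrite mxE.
  have -> : P (w + h) * (w 0 i + h 0 i) - P w * w 0 i -
     (l h * w 0 i + P w * h 0 i) =
     (P (w + h) - P w - l h) * (w 0 i + h 0 i) + l h * h 0 i by ring.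
  apply: le_trans (le_normcD _ _) _; rewrite !normcM.
  have h1 : normc (P (w + h) - P w - l h) * normc (w 0 i + h 0 i) <=
      A * eta ^+ 2 * (r + 1).
    apply: ler_pM; rewrite ?normc_ge0 ?lrem//.
    by apply: le_trans (le_normcD _ _) _; have := he i; lra.
  have h2 : normc (l h) * normc (h 0 i) <= A * eta * eta.
    by apply: ler_pM; rewrite ?normc_ge0 ?lle.
  have : 0 <= A * eta ^+ 2 by rewrite mulr_ge0// sqr_ge0.
  have : 0 <= A * eta ^+ 2 * r by rewrite !mulr_ge0// sqr_ge0.
  rewrite -mulrA -expr2 in h2; lra.
Qed.

(** Build the monomial by multiplying by one coordinate at a time: deg al
    steps. *)
Lemma jet_mono w (r : R) : (forall i, normc (w 0 i) <= r) -> forall al,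
  exists l, jet w ((2 * (r + 1)) ^+ deg al) (mono^~ al) l.
Proof.
move=> wr al; rewrite /deg /mono.
elim: (index_enum _) => [|i s [l IH]].
  exists (fun=> 0); split.
  - by rewrite !big_nil normc1 expr0.
  - by move=> *; rewrite mulr0 addr0.
  - by move=> h eta [e0 _]; rewrite normc0 big_nil expr0 mul1r.
  - by move=> h eta [e0 _] _; rewrite !big_nil subrr subr0 normc0 expr0 mul1r sqr_ge0.
rewrite big_cons.
suff [l' Hl'] : exists l', jet w ((2 * (r + 1)) ^+ (al i + \sum_(j <- s) al j))
    (fun z => z 0 i ^+ al i * \prod_(j <- s) z 0 j ^+ al j) l'.
  exists l'; move: Hl'; congr jet; apply/funext => z; by rewrite big_cons.
elim: (al i) => [|a [l' IHa]].
  by exists l; rewrite add0n; move: IH; congr jet; apply/funext => z; rewrite expr0 mul1r.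
have [l'' H] := jet_mul_coord (wr i) IHa; exists l''; move: H; congr jet.
  by rewrite -exprSr addSn.
by apply/funext => z; rewrite exprSr; ring.
Qed.

End monomial_jets.

Section power_series.
Context {R : realType} {n : nat}.
Notation multi := ('I_n -> nat).
Notation C := R[i].

(** Decay faster than every geometric sequence: the power series with these
    coefficients converges everywhere. *)
Definition entire_coefs (c : multi -> C) := forall rho : R, 0 < rho ->
  exists2 M : R, 0 <= M & forall al, normc (c al) * rho ^+ deg al <= M.

Variables (c : multi -> C) (z0 : 'rV[C]_n).
Hypothesis hc : entire_coefs c.

Lemma coord_bound (w : 'rV[C]_n) : exists r : R, coord_le w r.
Proof.
exists (\sum_i normc (w 0 i)); split.
  by apply: sumr_ge0 => i _; exact: normc_ge0.
by move=> i; rewrite (bigD1 i)//= lerDl sumr_ge0// => j _; exact: normc_ge0.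
Qed.

Lemma half_lt1 : 0 <= (2^-1 : R) < 1.
Proof. lra. Qed.

Lemma entire_coefs_dominated (K : R) : 0 < K ->
  exists2 M : R, 0 <= M & forall (B : R) (u : multi -> C), 0 <= B ->
    (forall al, normc (u al) <= B * K ^+ deg al) ->
    geom_dominated (M * B) 2^-1 (fun al => c al * u al).
Proof.
move=> K0; have K2 : 0 < 2 * K by rewrite mulr_gt0.
have [M M0 hM] := hc K2; exists M => // B u B0 hu al.
rewrite normcM exprVn ler_pdivlMr ?exprn_gt0//.
have h1 : normc (c al) * normc (u al) <= normc (c al) * (B * K ^+ deg al).
  by rewrite ler_wpM2l ?normc_ge0.
have p2 : 0 <= (2 : R) ^+ deg al by rewrite exprn_ge0.
apply: le_trans (ler_wpM2r p2 h1) _.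
have -> : normc (c al) * (B * K ^+ deg al) * 2 ^+ deg al =
  normc (c al) * (2 * K) ^+ deg al * B by rewrite exprMn; ring.
by rewrite ler_wpM2r.
Qed.

Lemma power_series_summable w : csummable (fun al => c al * mono w al).
Proof.
have [r [r0 hr]] := coord_bound w.
have K0 : 0 < 2 * (r + 1) by lra.
have [M M0 hM] := entire_coefs_dominated K0; exists (M * 1), 2^-1; split.
- by rewrite mulr1.
- exact: half_lt1.
apply: hM => // al; have [l [h _ _ _]] := jet_mono hr al.
by rewrite mul1r.
Qed.

(** Summing the expansions of the monomials: their constants K ^ deg al are
    outweighed by the coefficients, so values, linear parts and remainders can
    be summed separately. *)
Lemma power_series_expansion w : exists l : 'rV[C]_n -> C,
  (forall a h h', l (a *: h + h') = a * l h + l h') /\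
  exists2 B : R, 0 <= B & (forall h eta, coord_le h eta -> normc (l h) <= B * eta) /\
  (forall h eta, coord_le h eta -> eta <= 1 ->
   normc (csum (fun al => c al * mono (w + h) al) -
     csum (fun al => c al * mono w al) - l h) <= B * eta ^+ 2).
Proof.
have [r [r0 hr]] := coord_bound w.
have K0 : 0 < 2 * (r + 1) by lra.
have [M M0 hM] := entire_coefs_dominated K0.
have [l hl] := choice (jet_mono hr).
have lle h eta : coord_le h eta -> geom_dominated (M * eta) 2^-1 (fun al => c al * l al h).
  move=> hh; apply: hM; first by case: hh.
  by move=> al; have [_ _ h1 _] := hl al; rewrite mulrC; exact: h1.
have lsum h : csummable (fun al => c al * l al h).
  have [e he] := coord_bound h; exists (M * e), 2^-1; split.
  - by rewrite mulr_ge0//; case: he.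
  - exact: half_lt1.
  - exact: lle.
exists (fun h => csum (fun al => c al * l al h)); split.
  move=> a h h'.
  have -> : (fun al => c al * l al (a *: h + h')) =
      (fun al => a * (c al * l al h) + 1 * (c al * l al h')).
    by apply/funext => al; have [_ -> _ _] := hl al; ring.
  by rewrite csum_lin ?mul1r//; exact: csummable_lin.
have B0 : 0 <= (1 - 2^-1 : R)^-1 ^+ n by rewrite exprn_ge0// invr_ge0; lra.
exists (M * (1 - 2^-1)^-1 ^+ n); first by rewrite mulr_ge0.
split=> [h eta hh|h eta hh e1].
  rewrite mulrAC; apply: csum_bound; [|exact: half_lt1|exact: lle].
  by rewrite mulr_ge0//; case: hh.
have s1 := power_series_summable (w + h).
have s0 := power_series_summable w.
have s10 := csummable_lin 1 (-1) s1 s0.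
have E : csum (fun al => c al * mono (w + h) al) -
     csum (fun al => c al * mono w al) - csum (fun al => c al * l al h) =
     csum (fun al => c al * (mono (w + h) al - mono w al - l al h)).
  have -> : (fun al => c al * (mono (w + h) al - mono w al - l al h)) =
    (fun al => 1 * (1 * (c al * mono (w + h) al) + (-1) * (c al * mono w al))
       + (-1) * (c al * l al h)).
    by apply/funext => al; ring.
  rewrite csum_lin//; last exact: csummable_lin.
  by rewrite csum_lin//; ring.
rewrite E mulrAC; apply: csum_bound; [|exact: half_lt1|].
  by rewrite mulr_ge0 ?sqr_ge0.
apply: hM; first exact: sqr_ge0.
by move=> al; have [_ _ _ h1] := hl al; rewrite mulrC; exact: h1.
Qed.

Lemma coord_le_norm (h : 'rV[C]_n) : exists2 eta : R, `|h| = (eta%:C)%C & coord_le h eta.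
Proof.
have nR : `|h| \is Num.real by rewrite realE normr_ge0.
have [eta he] := complex_realP _ nR; exists eta => //; split.
  by have := normr_ge0 h; rewrite he lecR.
move=> i; rewrite -lecR -normcE_norm -he [leRHS]/Num.Def.normr /= mx_normE.
rewrite -[leLHS]nngE num_le.
exact: (le_bigmax _ (fun ij : 'I_1 * 'I_n => `|h ij.1 ij.2|%:nng) (0, i)).
Qed.

(** The linear part of the expansion is bounded, hence continuous, and the
    remainder is quadratic, hence negligible. *)
Lemma power_series_entire :
  entire (fun z => csum (fun al => c al * mono (z - z0) al)).
Proof.
move=> z; pose F (z : 'rV[C]_n) : C^o := csum (fun al => c al * mono (z - z0) al).
suff : differentiable F z by [].
have [l [llin [B B0 [lle lrem]]]] := power_series_expansion (z - z0).
(* Declared as normed modules because the topologies are inferred from it. *)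
pose V : normedModType C := 'rV[C]_n; pose W : normedModType C := C^o.
pose L : {linear V -> W} := HB.pack (l : V -> W)
  (GRing.isLinear.Build _ _ _ _ (l : V -> W) llin).
have Lc : continuous L.
  apply/linear_bounded_continuous/linear_boundedP.
  near=> r => x; have [eta -> hx] := coord_le_norm x.
  have -> : `|L x| = (normc (l x))%:C%C by exact: normcE_norm.
  have Br : (B%:C)%C <= r.
    by near: r; apply: nbhs_pinfty_ge; rewrite complex_real.
  apply: le_trans (_ : ((B * eta)%:C)%C <= _); first by rewrite lecR lle.
  rewrite rmorphM ler_wpM2r//; case: hx => e0 _; by rewrite lecR.
have FE : (F : V -> W) \o shift z = cst (F z : W) + L +o_ (0 : V) id.
  apply/eqaddoP => _/posnumP[e].
  (* Radii and tolerances of the topology of R[i] are positive elements of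
     R[i], hence real. *)
  pose e' := complex.Re e%:num.
  have eE : e%:num = (e'%:C)%C.
    have : 0 < e%:num by [].
    by rewrite ltcE /e' => /andP[/eqP /= + _]; case: (e%:num) => a b /= ->.
  have e0 : 0 < e'.
    by have h : 0 < e%:num by []; move: h; rewrite eE ltcR.
  pose d := Num.min 1 (e' / (B + 1)).
  have d0 : 0 < d by rewrite lt_min ltr01 divr_gt0//; lra.
  apply/nbhs_ballP; exists ((d%:C)%C); first by rewrite /= ltcR.
  move=> h; rewrite -ball_normE /= sub0r normrN.
  have [eta hE hh] := coord_le_norm h; rewrite hE ltcR lt_min ltr_pdivlMr; last lra.
  move=> /andP[e1 e2].
  have -> : (((F : V -> W) \o shift z) - (cst (F z : W) + L)) h = F (h + z) - F z - l h.
    by rewrite -![(_ + _ : _ -> _) _]/(_ + _) -![(- _ : _ -> _) _]/(- _) opprD addrA.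
  have -> : F (h + z) = csum (fun al => c al * mono ((z - z0) + h) al).
    by rewrite /F; congr csum; apply/funext => al; rewrite -[h + z - z0]addrA [h + _]addrC.
  rewrite normcE_norm eE -rmorphM /= lecR.
  apply: le_trans (lrem h eta hh (ltW e1)) _.
  have [eta0 _] := hh; rewrite expr2; nra.
have dE := diff_unique Lc FE.
by apply/diff_locallyP; rewrite dE.
Unshelve. all: by end_near. Qed.

End power_series.

(** * Taylor's formula, one coordinate at a time *)

Section one_variable_taylor.
Context {R : realType}.


Lemma is_derive_taylor_kernel (t s : R) N :
  is_derive s 1 (fun s : R => (t - s) ^+ N.+1 / (N.+1)`!%:R)
    (- ((t - s) ^+ N / N`!%:R)).
Proof.
have -> : (fun s : R => (t - s) ^+ N.+1 / (N.+1)`!%:R) =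
    ((N.+1)`!%:R^-1 \*: ((cst t - id) ^+ N.+1)).
  apply/funext => x /=; rewrite -[RHS]/(_ * _) mulrC; congr (_ * _).
  have fX (f : R -> R) n : (f ^+ n) x = (f x) ^+ n.
    by elim: n => [|n IH] //; rewrite !exprS -IH.
  by rewrite fX.
have h := is_deriveB (is_derive_cst t s 1) (is_derive_id s 1).
have := is_deriveZ (N.+1)`!%:R^-1 (is_deriveX N.+1 h).
rewrite /GRing.scale /=; congr (is_derive _ _ _ _).
rewrite -[(cst t - id) s]/(t - s) factS natrM.
have f0 : N`!%:R != 0 :> R by rewrite pnatr_eq0 -lt0n fact_gt0.
by rewrite sub0r mulrN1 mulrN; congr (- _); field; rewrite f0 addrC natr1 pnatr_eq0.
Qed.

(** Differentiate the Taylor polynomial of D 0 at t with respect to its centre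
    s: the sum telescopes to (t - s)^N / N! D_{N+1}(s). The mean value theorem
    between the centres 0 and t gives the bound, with a factor N.+1 that
    geometric decay absorbs. *)
Lemma taylor_remainder (D : nat -> R -> R) (N : nat) (B t : R) :
  (forall a (s : R), is_derive s 1 (D a) (D a.+1 s)) ->
  (forall s, `|D N.+1 s| <= B) ->
  `|D 0%N t - \sum_(a < N.+1) t ^+ a / a`!%:R * D a 0| <=
    N.+1%:R * (`|t| ^+ N.+1 / (N.+1)`!%:R) * B.
Proof.
move=> dD hB.
pose phi N s := \sum_(a < N.+1) (t - s) ^+ a / a`!%:R * D a s.
have dphi (s : R) : is_derive s 1 (phi N) ((t - s) ^+ N / N`!%:R * D N.+1 s).
  rewrite /phi; elim: N {hB} => [|m IH].
    have -> : (fun s => \sum_(a < 1) (t - s) ^+ a / a`!%:R * D a s) = D 0%N.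
      by apply/funext => x; rewrite big_ord1 expr0 fact0 divr1 mul1r.
    by rewrite expr0 fact0 divr1 mul1r.
  have -> : (fun s => \sum_(a < m.+2) (t - s) ^+ a / a`!%:R * D a s) =
    (fun s => \sum_(a < m.+1) (t - s) ^+ a / a`!%:R * D a s) +
    ((fun s => (t - s) ^+ m.+1 / (m.+1)`!%:R) * D m.+1).
    by apply/funext => x; rewrite big_ord_recr.
  have := is_deriveD IH (is_deriveM (is_derive_taylor_kernel t s m) (dD m.+1 s)).
  by congr (is_derive _ _ _ _); rewrite /GRing.scale /=; ring.
have phit : phi N t = D 0%N t.
  rewrite /phi big_ord_recl big1 => [|a _]; first by rewrite expr0 fact0 divr1 mul1r addr0.
  by rewrite subrr expr0n !mul0r.
have phi0 : phi N 0 = \sum_(a < N.+1) t ^+ a / a`!%:R * D a 0.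
  by apply: eq_bigr => a _; rewrite subr0.
rewrite -phit -phi0.
have bound s : `|s| <= `|t| -> 0 <= s * t ->
    `|(t - s) ^+ N / N`!%:R * D N.+1 s| <= `|t| ^+ N / N`!%:R * B.
  move=> st st0; rewrite normrM; apply: ler_pM => //.
  rewrite normrM normrX [`|_^-1|]ger0_norm ?invr_ge0 ?ler0n// ler_wpM2r ?invr_ge0 ?ler0n//.
  apply: lerXn2r; rewrite ?nnegrE//.
  move: st; case: (lerP 0 s) => s0; case: (lerP 0 t) => t0;
    rewrite ?(ger0_norm s0) ?(ltr0_norm s0) ?(ger0_norm t0) ?(ltr0_norm t0) => st;
    rewrite ler_norml; nra.
have fin : `|t| ^+ N / N`!%:R * B * `|t| = N.+1%:R * (`|t| ^+ N.+1 / (N.+1)`!%:R) * B.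
  rewrite factS natrM exprS.
  have f0 : N`!%:R != 0 :> R by rewrite pnatr_eq0 -lt0n fact_gt0.
  by rewrite invfM; field; rewrite f0 addrC natr1 pnatr_eq0.
rewrite -fin.
case: (leP 0 t) => t0.
  have [c /andP[c0 ct] ->] := is_derive_MVT t0 dphi.
  rewrite normrM subr0 ler_wpM2r// bound// ?mulr_ge0//.
  by rewrite !ger0_norm.
have [c /andP[tc c0] E] := is_derive_MVT (ltW t0) dphi.
rewrite distrC E normrM sub0r normrN ler_wpM2r// bound//; last by nra.
by rewrite !ler0_norm ?(ltW t0)//; lra.
Qed.

End one_variable_taylor.

Section partial_derivatives.
Context {R : realType} {n : nat}.
Implicit Types (u : 'rV[R]_n -> R) (x h : 'rV[R]_n) (al : 'I_n -> nat).

Lemma is_derive_partial u (i : 'I_n) x (s : R) :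
  (forall x, derivable u x (delta_mx 0 i)) ->
  is_derive s 1 (fun s : R => u (x + s *: delta_mx 0 i))
    (partial i u (x + s *: delta_mx 0 i)).
Proof.
move=> du; have H := du (x + s *: delta_mx 0 i).
have E : (fun k : R => k^-1 *: (((fun s : R => u (x + s *: delta_mx 0 i)) \o shift s)
     (k *: (1 : R)) - u (x + s *: delta_mx 0 i))) =
  (fun k : R => k^-1 *: ((u \o shift (x + s *: delta_mx 0 i)) (k *: delta_mx 0 i)
     - u (x + s *: delta_mx 0 i))).
  apply/funext => k /=; congr (_ *: (u _ - _)).
  by rewrite -[k *: 1]/(k * 1) mulr1 scalerDl addrCA.
split; first by rewrite /derivable E.
by rewrite /partial /derive E.
Qed.

Lemma mpartial_foldr al u : exists s, mpartial al u = foldr partial u s.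
Proof.
rewrite /mpartial; elim: (enum _) => [|i l [s IH]]; first by exists [::].
by exists (nseq (al i) i ++ s); rewrite foldr_cat /= IH; elim: (al i) => //= a ->.
Qed.

Lemma derivable_mpartial al u i a : smooth u ->
  forall x, derivable (iter a (partial i) (mpartial al u)) x (delta_mx 0 i).
Proof.
move=> su x; have [s ->] := mpartial_foldr al u.
have -> : iter a (partial i) (foldr partial u s) = foldr partial u (nseq a i ++ s).
  by rewrite foldr_cat; elim: a => //= a ->.
by have [_] := su (nseq a i ++ s); apply.
Qed.

(** All coordinates before i have exponent 0, so the derivatives along i are
    the last ones taken and can be peeled off. *)
Lemma mpartial_upd al u i a pre l : enum 'I_n = pre ++ i :: l -> supported l al ->
  mpartial (upd al i a) u = iter a (partial i) (mpartial al u).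
Proof.
move=> E hal; rewrite /mpartial E.
have := enum_uniq 'I_n; rewrite E cat_uniq /= => /and4P[_ /norP[ip pl] il _].
have zero (be : 'I_n -> nat) v : (forall j, j \in pre -> be j = 0%N) ->
    foldr (fun j v => iter (be j) (partial j) v) v pre = v.
  elim: pre {E ip pl} => //= j p IH hb; rewrite IH ?hb ?mem_head//.
  by move=> k kp; apply: hb; rewrite inE kp orbT.
have jpre j : j \in pre -> j != i /\ al j = 0%N.
  move=> jp; split; first by apply: contraNneq ip => <-.
  by apply: hal; apply: contraNN pl => jl; apply/hasP; exists j.
rewrite !foldr_cat !zero /=.
- rewrite {1}/upd eqxx (hal i il) /=; congr (iter _ _ _).
  elim: l il {E hal pl} => //= j l IH; rewrite inE negb_or => /andP[ij il].
  by rewrite IH// /upd eq_sym (negbTE ij).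
- by move=> j /jpre[].
- by move=> j /jpre[ji aj]; rewrite /upd (negbTE ji).
Qed.

(** Splits the i-th factor off monomials and multi-index factorials when i was
    not used yet. *)
Lemma prod_upd {A : comPzRingType} (F : 'I_n -> nat -> A) al i a : al i = 0%N ->
  F i 0%N = 1 -> \prod_(j < n) F j (upd al i a j) = F i a * \prod_(j < n) F j (al j).
Proof.
move=> ai F1; rewrite (bigD1 i)//= [in RHS](bigD1 i)//= ai F1 mul1r.
rewrite {1}/upd eqxx; congr (_ * _); apply: eq_bigr => j ji.
by rewrite /upd (negbTE ji).
Qed.

End partial_derivatives.

Section taylor.
Context {R : realType} {n : nat}.
Variables (u : 'rV[R]_n -> R) (h : 'rV[R]_n).
Hypothesis su : smooth u.

Definition rmono (al : 'I_n -> nat) : R := \prod_(i < n) h 0 i ^+ al i.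

Definition taylor_term x al : R := mpartial al u x / (mfact al)%:R * rmono al.

Definition restr (l : seq 'I_n) : 'rV[R]_n := \row_i (if i \in l then h 0 i else 0).

Lemma mfactE (al : 'I_n -> nat) : (mfact al)%:R = \prod_(i < n) (al i)`!%:R :> R.
Proof. by rewrite /mfact natr_prod. Qed.

Variables (M q : R).
Hypothesis q01 : 0 <= q < 1.
Hypothesis dom : forall x al, `|taylor_term x al| <= M * q ^+ deg al.

(** Induction on the list of coordinates. The increment along the first one,
    i, is treated last: the induction hypothesis at the point moved along i
    expands u in the other coordinates, and then each derivative in that
    expansion is expanded in the i-th one. All remainders are bounded by N.+1
    times terms of the series with exponent N.+1 at i, so that their sum is at
    most a geometric sum times N.+1 q ^ N.+1. *)
Lemma taylor_box (N : nat) pre l : enum 'I_n = pre ++ l -> forall x,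
  `|u (x + restr l) - bsum N.+1 l (taylor_term x)| <=
  (size l)%:R * (N.+1%:R * q ^+ N.+1 * (M * (1 - q)^-1 ^+ n)).
Proof.
have [q0 q1] := andP q01.
have M0 : 0 <= M.
  have := dom 0 (fun=> 0%N); rewrite /deg big1// expr0 mulr1; exact: le_trans.
elim: l pre => [|i l IH] pre E x.
  rewrite mul0r (_ : restr [::] = 0) ?addr0; last first.
    by apply/rowP => i; rewrite !mxE in_nil.
  rewrite /= /taylor_term /rmono mfactE !big1// ?mulr1 ?divr1.
  rewrite /mpartial.
  have -> : foldr (fun i v => iter 0 (partial i) v) u (enum 'I_n) = u by elim: (enum _).
  by rewrite subrr normr0.
have E' : enum 'I_n = rcons pre i ++ l by rewrite cat_rcons.
have := enum_uniq 'I_n; rewrite E cat_uniq /= => /and4P[_ _ il ul].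
set e : 'rV[R]_n := delta_mx 0 i.
have xE : x + restr (i :: l) = (x + h 0 i *: e) + restr l.
  rewrite -addrA; congr (_ + _); apply/rowP => j; rewrite !mxE inE eqxx /=.
  case: eqP => [->|_]; first by rewrite (negbTE il) mulr1 addr0.
  by rewrite mulr0 add0r.
have {}IH := IH _ E' (x + h 0 i *: e); rewrite -xE in IH.
have hl : (size l <= n)%N.
  by rewrite -[X in (_ <= X)%N]size_enum_ord E size_cat /= addnS leqW// leq_addl.
have step : `|bsum N.+1 l (taylor_term (x + h 0 i *: e)) -
    bsum N.+1 (i :: l) (taylor_term x)| <= N.+1%:R * q ^+ N.+1 * (M * (1 - q)^-1 ^+ n).
  rewrite /= -bsum_sum.
  pose t al := taylor_term (x + h 0 i *: e) al -
    \sum_(a < N.+1) taylor_term x (upd al i a).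
  have -> : bsum N.+1 l (taylor_term (x + h 0 i *: e)) -
      bsum N.+1 l (fun al => \sum_(a < N.+1) taylor_term x (upd al i a)) =
      bsum N.+1 l t.
    apply/eqP; rewrite subr_eq -bsumD; apply/eqP; apply: bsum_eq => al _.
    by rewrite subrK.
  pose s al := N.+1%:R * q ^+ N.+1 * M * q ^+ mdeg l al.
  have ts al : supported l al -> `|t al| <= s al.
    move=> hal.
    have ai : al i = 0%N by apply: hal.
    (* Expand the al-th derivative along the line in direction i. *)
    pose D a y := iter a (partial i) (mpartial al u) (x + y *: e).
    have dD a (y : R) : is_derive y 1 (D a) (D a.+1 y).
      by apply: is_derive_partial => z; exact: derivable_mpartial.
    pose C := rmono al / (mfact al)%:R.
    have tE a y : mpartial (upd al i a) u (x + y *: e) / (mfact (upd al i a))%:R *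
        rmono (upd al i a) = C * ((h 0 i) ^+ a / a`!%:R * D a y).
      rewrite (mpartial_upd _ _ E hal) /rmono !mfactE.
      rewrite (prod_upd (F := fun j a => h 0 j ^+ a))// (prod_upd (F := fun j a => a`!%:R))//.
      rewrite /C /rmono mfactE invfM /D; ring.
    have t0 : taylor_term (x + h 0 i *: e) al = C * D 0%N (h 0 i).
      by rewrite /taylor_term /C /D /=; ring.
    have tsum : \sum_(a < N.+1) taylor_term x (upd al i a) =
        C * \sum_(a < N.+1) (h 0 i) ^+ a / a`!%:R * D a 0.
      rewrite mulr_sumr; apply: eq_bigr => a _; rewrite -tE.
      by rewrite /taylor_term scale0r addr0.
    rewrite /t t0 tsum -mulrBr normrM.
    have mE : mdeg l al = deg al.
      rewrite -mdeg_enum /mdeg E big_cat /= big_cons ai add0n.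
      rewrite [X in (X + _)%N]big1_seq ?add0n// => j /andP[_ jp]; apply: hal.
      have := enum_uniq 'I_n; rewrite E cat_uniq /= => /and3P[_ /norP[_ pl] _].
      by apply: contraNN pl => jl; apply/hasP; exists j.
    have dE : deg (upd al i N.+1) = (N.+1 + mdeg l al)%N.
      rewrite mE /deg (bigD1 i)//= [in RHS](bigD1 i)//= ai add0n /upd eqxx.
      by congr addn; apply: eq_bigr => j /negbTE ->.
    (* Up to the factor C, the derivative of order N.+1 is a term of the
       series divided by |h_i|^(N+1) / (N+1)!; the degenerate cases are those
       in which this cannot be divided out. *)
    have [C0|C0] := eqVneq C 0.
      rewrite C0 normr0 mul0r /s !mulr_ge0 ?exprn_ge0//.
    have [h0|h0] := eqVneq (h 0 i) 0.
      rewrite h0 (_ : _ - _ = 0) ?normr0 ?mulr0 ?/s ?mulr_ge0 ?exprn_ge0//.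
      rewrite big_ord_recl big1 => [|a _]; last by rewrite expr0n !mul0r.
      by rewrite expr0 fact0 divr1 mul1r addr0 subrr.
    pose B := M * q ^+ deg (upd al i N.+1) / (`|C| * (`|h 0 i| ^+ N.+1 / (N.+1)`!%:R)).
    have K0 : 0 < `|C| * (`|h 0 i| ^+ N.+1 / (N.+1)`!%:R).
      by rewrite mulr_gt0 ?normr_gt0// divr_gt0 ?exprn_gt0 ?normr_gt0 ?ltr0n ?fact_gt0.
    have DB y : `|D N.+1 y| <= B.
      rewrite /B ler_pdivlMr// mulrC.
      apply: le_trans (dom (x + y *: e) (upd al i N.+1)).
      rewrite /taylor_term tE !normrM normrX.
      rewrite [`|(N.+1)`!%:R^-1|]ger0_norm ?invr_ge0 ?ler0n//.
      by rewrite -!mulrA.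
    apply: le_trans (ler_wpM2l (normr_ge0 C) (taylor_remainder (h 0 i) dD DB)) _.
    rewrite le_eqVlt; apply/orP; left; apply/eqP.
    rewrite /B /s dE exprD; field.
    by rewrite expf_neq0 ?normr_eq0// C0 pnatr_eq0 -lt0n fact_gt0.
  have : `|bsum N.+1 l t| <= bsum N.+1 l s.
    have := @bsum_normc_le R n N.+1 l (fun al => ((t al)%:C)%C) s.
    rewrite -(@bsum_morph _ _ _ (real_complex R)) ?rmorph0//; last exact: rmorphD.
    by rewrite normc_real; apply=> al hal; rewrite normc_real ts.
  move=> /le_trans; apply; rewrite /s bsumZ bsum_geom//.
  rewrite [leRHS]mulrA; apply: ler_wpM2l; first by rewrite !mulr_ge0 ?exprn_ge0.
  apply: (@le_trans _ _ ((1 - q)^-1 ^+ size l)).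
    by apply: lerXn2r; rewrite ?nnegrE ?geom_ge0// ?invr_ge0 ?geom_le//; lra.
  by apply: ler_weXn2l => //; rewrite invf_ge1; lra.
have -> : u (x + restr (i :: l)) - bsum N.+1 (i :: l) (taylor_term x) =
  (u (x + restr (i :: l)) - bsum N.+1 l (taylor_term (x + h 0 i *: e))) +
  (bsum N.+1 l (taylor_term (x + h 0 i *: e)) - bsum N.+1 (i :: l) (taylor_term x)).
  by rewrite subrKA.
apply: le_trans (ler_normD _ _) _.
by rewrite -natr1 mulrDl mul1r lerD.
Qed.

End taylor.

(** * Estimates for the Taylor coefficients *)

Section coefficient_bounds.
Context {R : realType} {n : nat}.
Notation C := R[i].
Implicit Types (phi : 'rV[R]_n -> R) (f : 'rV[R]_n -> C) (al : 'I_n -> nat).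

Lemma expR_natX (x : R) k : expR x ^+ k = expR (k%:R * x).
Proof. by rewrite -expRM_natl mulr_natl. Qed.

(** The supremum that defines the conjugate is at least its value at y = ln r.
    *)
Lemma conjugate_lower_bound phi al (r : 'I_n -> R) : (forall i, 0 < r i) ->
  (expeR (- young_fenchel (EFin \o exp_pullback phi) (mvec al)) <=
   (expR (phi (\row_i r i)) / \prod_i r i ^+ al i)%:E)%E.
Proof.
move=> r0; pose y : 'rV[R]_n := \row_i ln (r i).
have yE : map_mx expR y = \row_i r i.
  by apply/rowP => i; rewrite !mxE lnK// qualifE/=.
have -> : (expR (phi (\row_i r i)) / \prod_i r i ^+ al i)%:E =
    expeR (- (dotv (mvec al) y - phi (\row_i r i))%:E).
  rewrite /= opprB expRB; congr (_ / _)%:E.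
  rewrite /dotv expR_sum; apply: eq_bigr => i _.
  by rewrite !mxE -expR_natX lnK// qualifE/=.
rewrite lee_expeR leeN2; apply: ereal_sup_ubound; exists y => //.
by rewrite /exp_pullback /= yE.
Qed.

(** In [\bar R] a quotient by 0 is infinite unless the numerator vanishes, so
    the finiteness of [rho] yields this bound also where the conjugate is
    infinite. *)
Lemma coef_decay phi m f : (rho (exp_pullback phi) m f < +oo)%E ->
  exists2 B : R, 0 <= B & forall x al (r : 'I_n -> R), (forall i, 0 < r i) ->
    normc (cmpartial al f x) * (1 + enorm x) ^+ m * \prod_i r i ^+ al i <=
    B * (mfact al)%:R * expR (phi (\row_i r i)).
Proof.
move=> rfin; have [B B0 hB] : exists2 B : R, 0 <= B &
    (rho (exp_pullback phi) m f <= B%:E)%E.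
  case: (rho _ _ _) rfin => [b|//|] _; last by exists 0; rewrite ?leNye.
  by exists `|b| => //; rewrite lee_fin ler_norm.
exists B => // x al r r0.
have P0 : 0 < \prod_i r i ^+ al i by apply: prodr_gt0 => i _; rewrite exprn_gt0.
have f0 : (0 : R) < (mfact al)%:R.
  by rewrite ltr0n /mfact prodn_gt0// => i; exact: fact_gt0.
pose Y := young_fenchel (EFin \o exp_pullback phi) (mvec al).
have hE := conjugate_lower_bound phi al r0; rewrite -/Y in hE.
have hX : ((((1 + enorm x) ^+ m * normc (cmpartial al f x))%:E /
   ((mfact al)%:R%:E * expeR (- Y)))%E <= B%:E)%E.
  by apply: le_trans hB; apply: ereal_sup_ubound; exists (x, al).
rewrite [X in X * _ <= _]mulrC; move: hX.
set T := (1 + enorm x) ^+ m * _ => hX.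
have T0 : 0 <= T.
  by rewrite /T mulr_ge0 ?normc_ge0// exprn_ge0// addr_ge0 ?sqrtr_ge0.
case: (expeR (- Y)) (expeR_ge0 (- Y)) hE hX => [e|//|//].
rewrite !lee_fin => e0 hE; rewrite -EFinM inver mulf_eq0 (gt_eqF f0) /=.
case: eqP => [_|/eqP ne].
  case: (eqVneq T 0) => [->|Tn] h.
    by rewrite mul0r !mulr_ge0 ?expR_ge0 ?(ltW f0).
  by move: h; rewrite gt0_muley ?lte_fin ?lt_def ?Tn.
have {}e0 : 0 < e by rewrite lt_def ne.
rewrite -EFinM lee_fin ler_pdivrMr ?mulr_gt0// => h.
apply: le_trans (ler_wpM2r (ltW P0) h) _.
rewrite -!mulrA ler_wpM2l// ler_wpM2l ?(ltW f0)//.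
by rewrite -ler_pdivlMr.
Qed.

Definition taylor_coef f x al : C := cmpartial al f x / (mfact al)%:R.

(** Choosing r_i = |v_i| / q gives a geometric series of any ratio q < 1; r is
    kept free because it must be positive and because phi is evaluated there.
    *)
Lemma taylor_coef_dominated phi m f : (rho (exp_pullback phi) m f < +oo)%E ->
  exists2 B : R, 0 <= B & forall x (r : 'I_n -> R) (v : 'rV[C]_n) (q : R),
    (forall i, 0 < r i) -> 0 <= q -> (forall i, normc (v 0 i) <= q * r i) ->
    geom_dominated (B * expR (phi (\row_i r i)) / (1 + enorm x) ^+ m) q
      (fun al => taylor_coef f x al * mono v al).
Proof.
move=> /coef_decay[B B0 hB]; exists B => // x r v q r0 q0 hv al.
have P0 : 0 < \prod_i r i ^+ al i by apply: prodr_gt0 => i _; rewrite exprn_gt0.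
have f0 : (0 : R) < (mfact al)%:R.
  by rewrite ltr0n /mfact prodn_gt0// => i; exact: fact_gt0.
have x0 : 0 < (1 + enorm x) ^+ m by rewrite exprn_gt0// ltr_pwDl ?sqrtr_ge0.
have hm : normc (mono v al) <= q ^+ deg al * \prod_i r i ^+ al i.
  rewrite /mono normc_prod /deg -prodrXr -big_split /=.
  apply: ler_prod => i _; rewrite normcX exprn_ge0 ?normc_ge0//= -exprMn.
  by apply: lerXn2r; rewrite ?nnegrE ?normc_ge0// mulr_ge0// ltW.
rewrite normcM /taylor_coef normcM normcV normc_nat.
set D := normc (cmpartial al f x).
have D0 : 0 <= D / (mfact al)%:R by rewrite divr_ge0 ?normc_ge0// ltW.
apply: le_trans (ler_wpM2l D0 hm) _.
have -> : D / (mfact al)%:R * (q ^+ deg al * \prod_i r i ^+ al i) =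
  (D * (1 + enorm x) ^+ m * \prod_i r i ^+ al i) *
    (q ^+ deg al / ((mfact al)%:R * (1 + enorm x) ^+ m)).
  by field; rewrite (gt_eqF f0) (gt_eqF x0).
have -> : B * expR (phi (\row_i r i)) / (1 + enorm x) ^+ m * q ^+ deg al =
  (B * (mfact al)%:R * expR (phi (\row_i r i))) *
    (q ^+ deg al / ((mfact al)%:R * (1 + enorm x) ^+ m)).
  by field; rewrite (gt_eqF f0) (gt_eqF x0).
apply: ler_wpM2r; last exact: hB.
by rewrite divr_ge0 ?exprn_ge0// mulr_ge0 ?(ltW x0) ?(ltW f0).
Qed.

End coefficient_bounds.

(** * The entire extension *)

Section extension.
Context {R : realType} {n : nat}.
Notation C := R[i].
Variables (phi : 'rV[R]_n -> R) (f : 'rV[R]_n -> C).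
Hypothesis fE : calE (exp_pullback phi) f.

Definition taylor_sum (x : 'rV[R]_n) (z : 'rV[C]_n) : C :=
  csum (fun al => taylor_coef f x al * mono (z - real_to_complexV x) al).

Lemma taylor_coef_entire x : entire_coefs (taylor_coef f x).
Proof.
have [_ /(_ 0%N) /taylor_coef_dominated[B B0 hB]] := fE.
move=> s s0; exists (B * expR (phi (\row_i s)) / (1 + enorm x) ^+ 0).
  by rewrite expr0 divr1 mulr_ge0 ?expR_ge0.
move=> al.
have := hB x (fun=> s) (const_mx ((s%:C)%C)) 1 (fun=> s0) ler01 _ al.
rewrite expr1n mulr1 normcM.
have -> : normc (mono (const_mx (s%:C)%C) al) = s ^+ deg al.
  rewrite /mono normc_prod /deg -prodrXr; apply: eq_bigr => i _.
  by rewrite normcX mxE normc_real ger0_norm// ltW.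
by apply=> i; rewrite mxE normc_real mul1r ger0_norm// ltW.
Qed.

Lemma taylor_sum_entire x : entire (taylor_sum x).
Proof. exact: power_series_entire (taylor_coef_entire x). Qed.

(** As N < 2 ^ N, the ratio 1 / 4 leaves a factor 2 ^- N. *)
Lemma small_remainder (K : R) : 0 <= K -> forall e : R, 0 < e -> exists N0, forall N,
  (N0 <= N)%N -> N.+1%:R * (4^-1 : R) ^+ N.+1 * K < e.
Proof.
move=> K0 e e0; have K1 : 0 < K + 1 by lra.
have [||N0 hN0] := @expr_small R 2^-1 (e / (K + 1)).
- lra.
- by rewrite divr_gt0.
exists N0 => N hN.
have : N.+1%:R * (4^-1 : R) ^+ N.+1 <= 2^-1 ^+ N0.
  have -> : (4 : R) = 2 * 2 by ring.
  rewrite invfM exprMn mulrA.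
  have h1 : N.+1%:R * (2^-1 : R) ^+ N.+1 <= 1.
    rewrite exprVn ler_pdivrMr ?exprn_gt0// mul1r -natrX ler_nat.
    exact/ltnW/ltn_expl.
  have h2 : (2^-1 : R) ^+ N.+1 <= 2^-1 ^+ N0.
    by apply: ler_wiXn2l; rewrite ?invr_ge0 ?invf_le1 ?ler1n// leqW.
  apply: le_trans (_ : 1 * 2^-1 ^+ N.+1 <= _); last by rewrite mul1r.
  by rewrite ler_wpM2r// exprn_ge0// invr_ge0.
have p0 : 0 <= (2^-1 : R) ^+ N0 by rewrite exprn_ge0// invr_ge0.
move: hN0; rewrite ltr_pdivlMr// => h1 h2.
apply: le_lt_trans h1; apply: le_trans (ler_wpM2r K0 h2) _.
by rewrite ler_wpM2l//; lra.
Qed.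

(** The radii are chosen four times larger than the increment p - x, so that
    the series is dominated by a geometric one of ratio 1 / 4, uniformly in
    the centre, as the Taylor remainder requires. *)
Lemma taylor_sum_real x p : taylor_sum x (real_to_complexV p) = f p.
Proof.
have [[sRe sIm] /(_ 0%N) /taylor_coef_dominated[B B0 hB]] := fE.
pose h := p - x.
have vE : real_to_complexV p - real_to_complexV x = real_to_complexV h.
  by apply/rowP => i; rewrite !mxE rmorphB.
have [eta [eta0 heta]] := coord_bound (real_to_complexV h).
have r0 : 0 < 4 * (eta + 1) by lra.
pose M := B * expR (phi (\row_i (4 * (eta + 1)))).
have M0 : 0 <= M by rewrite mulr_ge0 ?expR_ge0.
have q01 : 0 <= (4^-1 : R) < 1 by lra.
have dom y : geom_dominated M 4^-1
    (fun al => taylor_coef f y al * mono (real_to_complexV h) al).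
  have := hB y (fun=> 4 * (eta + 1)) (real_to_complexV h) 4^-1 (fun=> r0).
  rewrite expr0 divr1; apply; first lra.
  by move=> i; have := heta i; lra.
have monoE al : mono (real_to_complexV h) al = ((rmono h al)%:C)%C.
  rewrite /mono /rmono rmorph_prod; apply: eq_bigr => i _.
  by rewrite rmorphXn mxE.
have tE y al : taylor_coef f y al * mono (real_to_complexV h) al =
  (taylor_term (@complex.Re R \o f) h y al +i*
   taylor_term (@complex.Im R \o f) h y al)%C.
  rewrite monoE /taylor_coef /cmpartial -(rmorph_nat (real_complex R)) -fmorphV.
  rewrite -mulrA -rmorphM /taylor_term.
  by apply/eqP; rewrite eq_complex /=; apply/andP; split; apply/eqP; ring.
have domR y al : `|taylor_term (@complex.Re R \o f) h y al| <= M * 4^-1 ^+ deg al.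
  apply: le_trans (dom y al); rewrite tE; exact: (normc_Re (_ +i* _)%C).
have domI y al : `|taylor_term (@complex.Im R \o f) h y al| <= M * 4^-1 ^+ deg al.
  apply: le_trans (dom y al); rewrite tE; exact: (normc_Im (_ +i* _)%C).
have hx : x + restr h (enum 'I_n) = p.
  by apply/rowP => i; rewrite !mxE mem_enum /= addrC subrK.
rewrite /taylor_sum vE.
have cv : cvgC (fun N => psum N (fun al => taylor_coef f x al *
    mono (real_to_complexV h) al)) (csum (fun al => taylor_coef f x al *
    mono (real_to_complexV h) al)).
  exact: csumP M0 q01 (dom x).
apply: (cvgC_unique cv) => e e0.
pose K := (n%:R * (M * (1 - 4^-1)^-1 ^+ n)) : R.
have K0 : 0 <= K.
  by rewrite !mulr_ge0// exprn_ge0// invr_ge0; lra.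
have e2 : 0 < e / 2 by rewrite divr_gt0.
have [N0 hN0] := small_remainder K0 e2.
exists N0.+1 => -[//|N] hN.
have TR := taylor_box sRe q01 domR N (erefl : enum 'I_n = [::] ++ enum 'I_n) x.
have TI := taylor_box sIm q01 domI N (erefl : enum 'I_n = [::] ++ enum 'I_n) x.
rewrite hx size_enum_ord in TR TI.
have KE : n%:R * (N.+1%:R * 4^-1 ^+ N.+1 * (M * (1 - 4^-1)^-1 ^+ n)) =
  N.+1%:R * 4^-1 ^+ N.+1 * K by rewrite /K; ring.
rewrite KE in TR TI; have hN' := hN0 N hN.
apply: le_lt_trans (normc_le_ReIm _) _; rewrite ReB ImB.
have -> : complex.Re (psum N.+1 (fun al => taylor_coef f x al *
    mono (real_to_complexV h) al)) =
    bsum N.+1 (enum 'I_n) (taylor_term (@complex.Re R \o f) h x).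
  rewrite /psum (@bsum_morph _ _ _ (@complex.Re R))//; last by move=> [? ?] [? ?].
  by apply: bsum_eq => al _; rewrite tE.
have -> : complex.Im (psum N.+1 (fun al => taylor_coef f x al *
    mono (real_to_complexV h) al)) =
    bsum N.+1 (enum 'I_n) (taylor_term (@complex.Im R \o f) h x).
  rewrite /psum (@bsum_morph _ _ _ (@complex.Im R))//; last by move=> [? ?] [? ?].
  by apply: bsum_eq => al _; rewrite tE.
rewrite distrC [X in _ + X]distrC.
by rewrite /= in TR TI *; lra.
Qed.

Lemma taylor_sum_extension x : entire_extension f (taylor_sum x).
Proof. by split; [exact: taylor_sum_entire|exact: taylor_sum_real]. Qed.

(** Both series are entire extensions of f. *)
Lemma taylor_sum_center x : taylor_sum x = taylor_sum 0.
Proof. exact: entire_extension_unique (taylor_sum_extension x) (taylor_sum_extension 0). Qed.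

End extension.

(** * Growth of the extension *)

Section growth.
Context {R : realType} {n : nat}.

Definition RePart (z : 'rV[R[i]]_n) : 'rV[R]_n := map_mx (@complex.Re R) z.

Lemma enorm_ge0 (x : 'rV[R]_n) : 0 <= enorm x.
Proof. exact: sqrtr_ge0. Qed.

Lemma cnorm_le_ReIm (z : 'rV[R[i]]_n) :
  1 + cnorm z <= (1 + enorm (RePart z)) * (1 + enorm (Defs.ImV z)).
Proof.
have hx := enorm_ge0 (RePart z); have hy := enorm_ge0 (Defs.ImV z).
have h : cnorm z <= enorm (RePart z) + enorm (Defs.ImV z).
  rewrite -[leRHS]ger0_norm ?addr_ge0// -sqrtr_sqr ler_wsqrtr//.
  have s0 (x : 'rV[R]_n) : 0 <= \sum_i x 0 i ^+ 2.
    by apply: sumr_ge0 => i _; exact: sqr_ge0.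
  rewrite sqrrD !sqr_sqrtr//.
  have -> : \sum_i normc (z 0 i) ^+ 2 =
      \sum_i RePart z 0 i ^+ 2 + \sum_i Defs.ImV z 0 i ^+ 2.
    rewrite -big_split; apply: eq_bigr => i _; rewrite !mxE.
    by case: (z 0 i) => a b /=; rewrite sqr_sqrtr// addr_ge0 ?sqr_ge0.
  by rewrite lerD2r lerDl mulrn_wge0// mulr_ge0.
nra.
Qed.

End growth.

Theorem theorem2 (R : realType) (n : nat) (n_gt0 : (0 < n)%N)
  (phi : nat -> 'rV[R]_n -> R)
  (phi_A : forall nu, (0 < nu)%N -> class_A (phi nu))
  (i0 : forall nu, (0 < nu)%N -> forall A : R, 0 < A ->
    exists2 C : R, 0 < C &
      forall x, phi nu x + A * ln (1 + enorm x) <= phi nu.+1 x + C)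
  (i1 : forall nu, (0 < nu)%N -> exists sigma gamma : R,
    [/\ 1 < sigma, 0 < gamma &
      forall x, phi nu (sigma *: x) <= phi nu.+1 x + gamma])
  (i2 : forall nu, (0 < nu)%N -> exists2 K : R, 0 < K &
    forall x xi : 'rV[R]_n, (forall i, 0 <= x 0 i) ->
      (forall i, 0 <= xi 0 i <= 1) ->
      phi nu (x + xi) <= phi nu.+1 x + K)
  (f : 'rV[R]_n -> R[i]) (fE : calE_Psi phi f) :
  exists F : 'rV[R[i]]_n -> R[i],
    unique (entire_extension f) F /\ E_Phi phi F.
Proof.
have [nu nu0 fnu] := fE.
have Fext := taylor_sum_extension fnu 0.
exists (taylor_sum f 0); split.
  by split=> // G; exact: entire_extension_unique.
have [K _ hK] := i2 nu nu0.
have [sigma [gamma [s1 _ hs]]] := i1 nu.+1 isT.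
exists nu.+3 => //; split; first by case: Fext.
move=> m; have m1 : 0 < m.+1%:R :> R by rewrite ltr0n.
(* The condition i0 requires a positive exponent, hence m + 1 rather than m.
   *)
have [A _ hA] := i0 nu.+2 isT _ m1.
have [_ /(_ m) /taylor_coef_dominated[B B0 hB]] := fnu.
pose q := sigma^-1; have s0 : 0 < sigma by lra.
have q0 : 0 <= q by rewrite invr_ge0 ltW.
have q1 : q < 1 by rewrite invf_lt1.
pose Q := (1 - q)^-1 ^+ n.
have Q0 : 0 <= Q by rewrite exprn_ge0// invr_ge0; lra.
apply: (@le_lt_trans _ _ (B * Q * expR (K + gamma + A))%:E); last exact: ltry.
apply: ge_ereal_sup => _ [z _ <-]; rewrite lee_fin.
set x := RePart z; set y := Defs.ImV z.
pose v := z - real_to_complexV x.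
have nv i : normc (v 0 i) = `|y 0 i|.
  rewrite !mxE; case: (z 0 i) => a b /=.
  by rewrite subrr expr0n /= add0r subr0 sqrtr_sqr.
(* The summand 1 keeps the radii positive where y_i = 0. *)
pose r i := sigma * `|y 0 i| + 1.
have r0 i : 0 < r i by rewrite ltr_wpDl// mulr_ge0// ltW.
have hv i : normc (v 0 i) <= q * r i.
  rewrite nv /r mulrDr mulr1 mulrA mulVf ?gt_eqF// mul1r lerDl.
  exact: q0.
have M0 : 0 <= B * expR (phi nu (\row_i r i)) / (1 + enorm x) ^+ m.
  by rewrite divr_ge0 ?mulr_ge0 ?expR_ge0// exprn_ge0// addr_ge0 ?enorm_ge0.
have q01 : 0 <= q < 1 by rewrite q0.
have bound : normc (taylor_sum f 0 z) <=
    B * expR (phi nu (\row_i r i)) / (1 + enorm x) ^+ m * Q.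
  rewrite -(taylor_sum_center fnu x).
  exact: csum_bound M0 q01 (hB x r v q r0 q0 hv).
pose ay : 'rV[R]_n := map_mx (fun t => `|t|) y.
have phir : phi nu (\row_i r i) <= phi nu.+2 y + gamma + K.
  have -> : \row_i r i = sigma *: ay + const_mx 1.
    by apply/rowP => i; rewrite !mxE /r /y !mxE.
  have h1 i : 0 <= (sigma *: ay) 0 i by rewrite !mxE mulr_ge0// ltW.
  have h2 i : 0 <= (const_mx 1 : 'rV[R]_n) 0 i <= 1 by rewrite !mxE ler01 lexx.
  apply: le_trans (hK _ _ h1 h2) _; rewrite lerD2r.
  have [_ sym _ _] := phi_A nu.+2 isT.
  by rewrite [in leRHS]sym; exact: hs.
have ny : 0 < 1 + enorm y by rewrite ltr_pwDl ?enorm_ge0.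
have nx : 0 < 1 + enorm x by rewrite ltr_pwDl ?enorm_ge0.
have yexp : (1 + enorm y) ^+ m <= expR (m.+1%:R * ln (1 + enorm y)).
  rewrite -expR_natX lnK ?qualifE//= ler_weXn2l//.
  by rewrite lerDl enorm_ge0.
have cz : (1 + cnorm z) ^+ m <= (1 + enorm x) ^+ m * (1 + enorm y) ^+ m.
  rewrite -exprMn; apply: lerXn2r; rewrite ?nnegrE.
  - by rewrite addr_ge0// sqrtr_ge0.
  - by rewrite mulr_ge0// ltW.
  - exact: cnorm_le_ReIm.
rewrite ler_pdivrMr ?expR_gt0//.
have c0 : 0 <= (1 + cnorm z) ^+ m by rewrite exprn_ge0// addr_ge0// sqrtr_ge0.
apply: le_trans (ler_pM (normc_ge0 _) c0 bound cz) _.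
have -> : B * expR (phi nu (\row_i r i)) / (1 + enorm x) ^+ m * Q *
    ((1 + enorm x) ^+ m * (1 + enorm y) ^+ m) =
    B * Q * (expR (phi nu (\row_i r i)) * (1 + enorm y) ^+ m).
  by field; rewrite expf_neq0// gt_eqF.
rewrite -[leRHS]mulrA; apply: ler_wpM2l; first by rewrite mulr_ge0.
apply: (@le_trans _ _ (expR (phi nu.+2 y + gamma + K) * expR (m.+1%:R * ln (1 + enorm y)))).
  by apply: ler_pM => //; rewrite ?expR_ge0 ?ler_expR// exprn_ge0// ltW.
rewrite -!expRD ler_expR; have := hA y; lra.
Qed.
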